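(* Let $\alpha=\alpha(n)$ be a function with $\alpha(n)\big/\big(\log n/n\big)^{1/4}\to\infty$ as $n\to\infty$. For each even $n$, let $H=H_n$ be a graph on vertex set $[n]$ with minimum degree $\delta(H)\geq \alpha n$ which contains a matching $M$ covering at least $n-f(n)$ vertices, where $f(n)=o(\alpha(n)^2 n)$. Then asymptotically almost surely $H\cup G_{n,1}$ is pancyclic.
   Context: $G_{n,1}$ denotes a uniformly random perfect matching on vertex set $[n]=\{1,\dots,n\}$ ($n$ even), viewed as a graph. The union $H\cup G$ of two graphs on the same vertex set $[n]$ is the graph on $[n]$ whose edge set is $E(H)\cup E(G)$. A graph on $n$ vertices is pancyclic if it contains a cycle of length $k$ for every $3\leq k\leq n$. An event holds asymptotically almost surely if its probability tends to $1$ as $n\to\infty$. *)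

(* Defs.v *)
From HB Require Import structures.
From mathcomp Require Import all_boot all_order all_algebra.
From mathcomp Require Import all_classical all_reals all_analysis.

Set Implicit Arguments.
Unset Strict Implicit.
Unset Printing Implicit Defensive.

Import Order.TTheory GRing.Theory Num.Theory.
Import numFieldNormedType.Exports.

Local Open Scope ring_scope.

(* A graph with vertex set [T] is given by its edge set, a set of unordered
   pairs; the union of two graphs is then the union [:|:] of edge sets. *)
Section Graphs.
Variable T : finType.
Implicit Types E M : {set {set T}}.

Definition simple_graph E : bool := [forall e in E, #|e| == 2%N].

Definition adj E : rel T := fun x y => [set x; y] \in E.

Definition degree E (x : T) : nat := #|[set e in E | x \in e]|.

(* The default value [#|T|] exceeds every degree of a simple graph, so it is
   only returned when [T] is empty. *)
Definition min_degree E : nat := \big[minn/#|T|]_(x : T) degree E x.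

Definition matching M : bool := simple_graph M && finset.trivIset M.

Definition perfect_matching M : bool :=
  matching M && (finset.cover M == [set: T]%SET).

(* [ucycleb (adj E) c] only means "c is a cycle" for [size c >= 3]. *)
Definition has_cycle E (k : nat) : bool :=
  [exists c : k.-tuple T, ucycleb (adj E) c].

Definition pancyclic E : bool :=
  [forall k : 'I_#|T|.+1, (3 <= k)%N ==> has_cycle E k].

(* Probability of [P] under the uniform distribution on the perfect matchings
   of [T]; meaningful when [#|T|] is even. *)
Definition prob_pm (R : realType) (P : pred {set {set T}}) : R :=
  #|[set M | perfect_matching M && P M]|%:R / #|[set M | perfect_matching M]|%:R.

End Graphs.

Definition even_oo : set_system nat :=
  within [set n : nat | ~~ odd n]%classic \oo%classic.

(* Main.v *)
Require Import Defs.
From HB Require Import structures.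
From mathcomp Require Import all_boot all_order all_algebra all_fingroup.
From mathcomp Require Import zify ring lra.

(* Proof idea. View the random perfect matching as a fixed-point-free involution
   g, and let M be the almost perfect matching of H, as an involution mu.
   Switching arguments show that, with probability tending to 1,
   (1) for all x, y there are at least D = c alpha^2 n vertices z with
       z in N(x) and g z in N(y), so that the edge {z, g z} can be replaced by
       any path from x to y;
   (2) the union of M and g has only few short cycles.
   By (2) the vertices are covered by at most c' D alternating paths of bounded
   length, each keeping its edges of g. A random colouring of these paths splits
   them into two classes A and B, each containing a constant fraction of the
   edges of (1) for every pair x, y. The paths of A are linked into one path W
   by edges of g taken from B. Closing an initial segment of W by one more edge
   of B gives the cycles of length at most |W| + 2; inserting the remaining
   paths of B, or initial segments of them, into the edges of g in A gives all
   greater lengths. *)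

Set Implicit Arguments.
Unset Strict Implicit.
Unset Printing Implicit Defensive.

Local Open Scope nat_scope.

(** * Switchings of fixed-point-free involutions *)

Lemma card_pair_dep (A B : finType) (P : pred A) (Q : A -> pred B) :
  #|[set u : A * B | P u.1 && Q u.1 u.2]| = \sum_(a | P a) #|[set b | Q a b]|.
Proof.
rewrite -sum1_card.
under [RHS]eq_bigr => a _ do rewrite -sum1_card.
rewrite pair_big_dep /=; apply: eq_bigl => -[a b].
by rewrite !inE.
Qed.

Section Switching.
Variable T : finType.
Implicit Types (g : {perm T}) (x y z : T).

Definition fpf_invol g := [forall x, (g x != x) && (g (g x) == x)].

Lemma fpf_involK g : fpf_invol g -> involutive g.
Proof. by move=> /forallP gP x; case/andP: (gP x) => _ /eqP. Qed.

Lemma fpf_invol_neq g x : fpf_invol g -> g x != x.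
Proof. by move=> /forallP /(_ x) /andP []. Qed.

Lemma fpf_invol_conj g s : fpf_invol g -> fpf_invol (g ^ s)%g.
Proof.
move=> gP; apply/forallP => x.
rewrite -(permKV s x) !permJ (inj_eq perm_inj) fpf_invol_neq //=.
by rewrite (fpf_involK gP).
Qed.

Lemma conj_tpermE g x y z : z != x -> z != y ->
  (g ^ tperm x y)%g z = tperm x y (g z).
Proof. by move=> zx zy; rewrite -{1}(@tpermD _ x y z) 1?eq_sym // permJ. Qed.

Lemma conj_tperm_out g x y z : fpf_invol g ->
  z \notin [:: x; y; g x; g y] -> (g ^ tperm x y)%g z = g z.
Proof.
move=> gP; rewrite !inE !negb_or => /and4P [zx zy zgx zgy].
rewrite conj_tpermE // tpermD // eq_sym.
  by apply: contraNneq zgx => <-; rewrite (fpf_involK gP).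
by apply: contraNneq zgy => <-; rewrite (fpf_involK gP).
Qed.

Lemma conj_tpermK g x y : ((g ^ tperm x y) ^ tperm x y = g)%g.
Proof. by rewrite -conjgM tperm2 conjg1. Qed.

Definition fpf_invols := [set g | fpf_invol g].

(** * Lower tail for the number of edges of a random matching between two sets *)

Section EdgeCount.
Variables S U : {set T}.

Definition hits g := [set z | (z \in S) && (g z \in U)].

Definition few_hits i := [set g | fpf_invol g && (#|hits g| <= i)].

(** Double counting of switchings. Giving [s] in [S] the new partner [t] in [U] creates a hit, and
    only [s], [t], [g s], [g t] can change partner. The new involution, [s] and the old partner of
    [s] determine [g] and [t]; for each new involution there are at most [(i + 4) * #|T|] choices of
    these two points. *)
Lemma few_hits_step i :
  #|S| * (#|U| - 2) * #|few_hits i| <= (i + 4) * #|T| * #|few_hits (i + 4)|.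
Proof.
pose P1 := [set u : {perm T} * (T * T) | (u.1 \in few_hits i) &&
  [&& u.2.1 \in S, u.2.2 \in U, u.2.2 != u.2.1 & u.1 u.2.1 != u.2.2]].
pose P2 := [set u : {perm T} * (T * T) | (u.1 \in few_hits (i + 4)) &&
  (u.2.1 \in hits u.1)].
pose phi (u : {perm T} * (T * T)) : {perm T} * (T * T) :=
  let: (g, (s, t)) := u in ((g ^ tperm (g s) t)%g, (s, g s)).
have phi_s g s t : fpf_invol g -> t != s -> (g ^ tperm (g s) t)%g s = t.
  move=> gP ts; rewrite conj_tpermE 1?eq_sym ?fpf_invol_neq // ?tpermL //.
have leP : #|P1| <= #|P2|.
  rewrite -(card_in_imset (f := phi) (D := P1)).
    apply: subset_leq_card; apply/subsetP => v /imsetP [[g [s t]]].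
    rewrite !inE /= => /andP [/andP [gP gX] /and4P [sS tU ts gst]] ->.
    rewrite /= fpf_invol_conj //= phi_s // sS tU /= andbT.
    apply: leq_trans (leq_add gX (leqnn 4)).
    apply: (@leq_trans #|hits g :|: [set z in [:: g s; t; g (g s); g t]]|).
      apply: subset_leq_card; apply/subsetP => z; rewrite !in_setU !in_set.
      case: (boolP (z \in [:: g s; t; g (g s); g t])) => [_ _|znin].
        by rewrite orbT.
      by rewrite conj_tperm_out // => ->.
    rewrite cardsU; apply: leq_trans (leq_subr _ _) _.
    by rewrite leq_add2l cardsE; exact: (card_size [:: g s; t; g (g s); g t]).
  move=> [g [s t]] [g' [s' t']]; rewrite !inE /=.
  move=> /andP [/andP [gP _] /and4P [_ _ ts _]].
  move=> /andP [/andP [gP' _] /and4P [_ _ ts' _]] [eg es ea].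
  rewrite es in ea ts eg *.
  have et : t = t'.
    by have := phi_s _ _ _ gP ts; rewrite eg phi_s.
  by congr (_, (_, _)) => //; rewrite -(conj_tpermK g (g s') t) eg ea et conj_tpermK.
have lb : #|S| * (#|U| - 2) * #|few_hits i| <= #|P1|.
  rewrite (card_pair_dep (mem (few_hits i)) (fun g (v : T * T) =>
    [&& v.1 \in S, v.2 \in U, v.2 != v.1 & g v.1 != v.2])).
  rewrite mulnC -sum_nat_const; apply: leq_sum => g _.
  rewrite [X in _ <= X](_ : _ = \sum_(s in S)
    #|[set t | [&& t \in U, t != s & g s != t]]|); last first.
    by rewrite -(card_pair_dep (mem S)
      (fun s t => [&& t \in U, t != s & g s != t])).
  rewrite -sum_nat_const; apply: leq_sum => s sS.
  (* Only [s] itself and its present partner are forbidden as values of [t]. *)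
  rewrite leq_subLR.
  have -> : [set t | [&& t \in U, t != s & g s != t]] = U :\: [set s; g s].
    by apply/setP => t; rewrite !inE negb_or (eq_sym (g s)) andbC.
  rewrite -{1}(cardsID [set s; g s] U) leq_add2r.
  apply: leq_trans (subset_leq_card (subsetIr _ _)) _.
  by rewrite cards2; case: (_ != _).
have ub : #|P2| <= (i + 4) * #|T| * #|few_hits (i + 4)|.
  rewrite (card_pair_dep (mem (few_hits (i + 4)))
    (fun g (v : T * T) => v.1 \in hits g)).
  rewrite mulnC -sum_nat_const; apply: leq_sum => g.
  rewrite !inE => /andP [_ gX].
  apply: (@leq_trans #|setX (hits g) [set: T]|).
    apply: subset_leq_card; apply/subsetP => -[s t].
    by rewrite !inE /= andbT.
  by rewrite cardsX cardsT leq_mul2r gX orbT.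
exact: leq_trans lb (leq_trans leP ub).
Qed.

(** Up to threshold [8 * D], raising the threshold by 4 at least doubles the count, because
    [(i + 4) * #|T| <= d ^ 2 / 4] is at most half of [d * (d - 2)]. Doing so [D] times leads from
    [D] to [5 * D]. *)
Lemma few_hits_tail d D : d <= #|S| -> d <= #|U| -> 4 <= d ->
  32 * D * #|T| <= d ^ 2 -> 2 ^ D * #|few_hits D| <= #|fpf_invols|.
Proof.
move=> dS dU d4 Dd.
have step i : i + 4 <= 8 * D -> 2 * #|few_hits i| <= #|few_hits (i + 4)|.
  move=> iD; have := few_hits_step i.
  have h1 : d * (d - 2) <= #|S| * (#|U| - 2) by apply: leq_mul => //; lia.
  have h2 : (i + 4) * #|T| <= 8 * D * #|T| by rewrite leq_mul2r iD orbT.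
  have h3 : 2 * ((i + 4) * #|T|) <= d * (d - 2) by nia.
  move=> h; have d0 : 0 < d * (d - 2) by rewrite muln_gt0; lia.
  rewrite -(leq_pmul2l d0).
  have h4 := leq_mul h1 (leqnn #|few_hits i|).
  have h5 := leq_mul h3 (leqnn #|few_hits (i + 4)|).
  lia.
have tail k : D + 4 * k <= 8 * D -> 2 ^ k * #|few_hits D| <= #|few_hits (D + 4 * k)|.
  elim: k => [|k IH] kD; first by rewrite muln0 addn0 mul1n.
  rewrite expnS -mulnA mulnS addnCA addnC.
  apply: leq_trans (step _ _); last lia.
  by rewrite leq_mul2l IH //; lia.
apply: leq_trans (tail D _) _; first lia.
by apply: subset_leq_card; apply/subsetP => g; rewrite !inE => /andP [].
Qed.

End EdgeCount.

(** * First moment of the number of short alternating cycles *)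

Section ShortCycles.
Variable mu : T -> T.
Hypothesis muK : involutive mu.

Definition turn g x := mu (g x).

(* The alternating walk from [v] through [g] and [mu] closes up after [j]
   steps and never traverses an edge of [g] twice. *)
Definition closes g v j :=
  let t := traject (turn g) v j in
  uniq (t ++ map g t) && (iter j (turn g) v == v).

Lemma turn_inj g : injective (turn g).
Proof. by move=> x y /(inv_inj muK) /perm_inj. Qed.

(** A switching opens the closed walk. Its last [g]-edge joins some [y] to [mu v]; swapping [mu v]
    with a point [a] off the cycle makes [a] the partner of [y]. The first [j] steps are unchanged,
    so the new involution determines [y], then [a], then [g]. *)
Lemma card_closes v j :
  #|[set g | fpf_invol g && closes g v j.+1]| * (#|T| - j.+1.*2) <=
    #|fpf_invols|.
Proof.
pose t g := traject (turn g) v j.+1.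
pose P1 := [set u : {perm T} * T | (fpf_invol u.1 && closes u.1 v j.+1) &&
  (u.2 \notin t u.1 ++ map u.1 (t u.1))].
pose phi (u : {perm T} * T) : {perm T} := (u.1 ^ tperm (mu v) u.2)%g.
have P1P g a : (g, a) \in P1 ->
  [/\ fpf_invol g, forall i, i <= j ->
       iter i (turn (phi (g, a))) v = iter i (turn g) v
     & phi (g, a) (iter j (turn g) v) = a].
  rewrite inE => /andP [/andP [gP /andP [ut /eqP cl]] at_].
  have {}gP : fpf_invol g := gP.
  have {}ut : uniq (t g ++ map g (t g)) := ut.
  have {}cl : iter j.+1 (turn g) v = v := cl.
  have {}at_ : a \notin t g ++ map g (t g) := at_.
  set y := iter j (turn g) v.
  have yt : y \in t g by apply/trajectP; exists j.
  have gy : g y = mu v by rewrite -cl iterS /turn muK.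
  have ny : g (mu v) = y by rewrite -gy (fpf_involK gP).
  move: at_; rewrite mem_cat negb_or => /andP [at1 at2].
  (* Since no [g]-edge is repeated, the vertices before [y] avoid the four points affected by the
     switching. *)
  have out z : z \in t g -> z != y -> z \notin [:: mu v; a; g (mu v); g a].
    move=> zt zy; rewrite !inE !negb_or ny zy /=; apply/and3P; split.
    - apply: contraTneq ut => zmu; rewrite cat_uniq; apply/nandP; right.
      rewrite negb_and negbK; apply/orP; left; apply/hasP; exists z => //.
      by rewrite zmu -gy map_f.
    - by apply: contraNneq at1 => <-.
    - by apply: contraNneq at2 => za; apply/mapP; exists z => //;
        rewrite za (fpf_involK gP).
  have it i : i <= j -> iter i (turn (phi (g, a))) v = iter i (turn g) v.
    elim: i => [//|i IH] ij; rewrite !iterS IH ?(ltnW ij) //.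
    congr mu; rewrite /phi /= conj_tperm_out //.
    apply: out; first by apply/trajectP; exists i => //; apply: leqW.
    apply: contraTneq ut => iy; rewrite cat_uniq.
    suff -> : uniq (t g) = false by [].
    apply/negbTE/negP => /(uniqP v).
    have sz : size (t g) = j.+1 by rewrite size_traject.
    move=> /(_ i j); rewrite !inE sz ltnS (ltnW ij) ltnSn => /(_ isT isT).
    rewrite !nth_traject //; last exact: leqW.
    by move=> /(_ iy); lia.
  split=> //; rewrite /phi /= conj_tpermE ?gy ?tpermL //.
    by rewrite -gy eq_sym fpf_invol_neq.
  by apply: contraNneq at1 => <-.
have inj : {in P1 &, injective phi}.
  move=> [g a] [g' a'] /P1P [gP it ya] /P1P [gP' it' ya'] e.
  have ea : a = a'.
    by rewrite -ya -ya' -it // -it' // e.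
  by congr (_, _) => //; move: e; rewrite /phi /= ea => /conjg_inj.
apply: (@leq_trans #|P1|).
  rewrite (card_pair_dep (fun g => fpf_invol g && closes g v j.+1)
    (fun g a => a \notin t g ++ map g (t g))).
  rewrite -sum_nat_const big_mkcond [X in _ <= X]big_mkcond /=.
  apply: leq_sum => g _; rewrite inE; case: ifP => // _.
  rewrite leq_subLR [X in _ <= X + _](_ : _ = size (t g ++ map g (t g))); last first.
    by rewrite size_cat size_map size_traject addnn.
  set s := t g ++ _.
  rewrite -cardsT -(cardsID [set z in s] [set: T]) leq_add //.
    rewrite setTI cardsE; exact: card_size.
  by apply: subset_leq_card; apply/subsetP => z; rewrite !inE andbT.
rewrite -(card_in_imset inj); apply: subset_leq_card.
apply/subsetP => _ /imsetP [[g a] /P1P [gP _ _] ->].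
by rewrite inE /phi fpf_invol_conj.
Qed.

Definition short_cycle_darts g l := [set v | [exists j : 'I_l, closes g v j.+1]].

(** Union bound over starting points and lengths: on average there are at most
    [#|T| * l / (#|T| - 2 * l)] such starting points. *)
Lemma card_short_cycle_darts l :
  (\sum_(g in fpf_invols) #|short_cycle_darts g l|) * (#|T| - l.*2) <=
    #|T| * l * #|fpf_invols|.
Proof.
have -> : #|T| * l * #|fpf_invols| = \sum_(v : T) \sum_(j < l) #|fpf_invols|.
  under eq_bigr => v _ do rewrite sum_nat_const card_ord.
  by rewrite sum_nat_const mulnA.
apply: (@leq_trans (\sum_(v : T) \sum_(j < l)
    (#|[set g | fpf_invol g && closes g v j.+1]| * (#|T| - l.*2)))).
  under [X in _ <= X]eq_bigr => v _ do rewrite -big_distrl /=.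
  rewrite -big_distrl /= leq_mul2r; apply/orP; right.
  under eq_bigr => g _ do rewrite -sum1_card big_mkcond /=.
  rewrite exchange_big /=; apply: leq_sum => v _.
  under [X in _ <= X]eq_bigr => j _ do rewrite -sum1_card big_mkcond /=.
  rewrite exchange_big /= [X in _ <= X](bigID (mem fpf_invols)) /=.
  apply: leq_trans (leq_addr _ _); apply: leq_sum => g; rewrite inE => gP.
  rewrite inE; case: existsP => // -[j jc].
  by rewrite (bigD1 j) //= inE gP jc.
apply: leq_sum => v _; apply: leq_sum => j _.
apply: leq_trans (card_closes v j); rewrite leq_mul2l; apply/orP; right.
by apply: leq_sub2l; rewrite leq_double.
Qed.

End ShortCycles.
End Switching.

(** * Covers by alternating paths *)

Lemma count_has_flatten (A : eqType) (a : pred A) (ss : seq (seq A)) :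
  count (has a) ss <= count a (flatten ss).
Proof.
elim: ss => //= s ss IH; rewrite count_cat leq_add // has_count.
by case: (count a s).
Qed.

Lemma count_le_card (A : finType) (a : pred A) (s : seq A) :
  uniq s -> count a s <= #|a|.
Proof.
move=> us; rewrite -size_filter -(card_uniqP _) ?filter_uniq //.
by apply: subset_leq_card; apply/subsetP => x; rewrite mem_filter => /andP [].
Qed.

Lemma mul_count_size_flatten (A : Type) l (ss : seq (seq A)) :
  l * count (fun s => l < size s) ss <= size (flatten ss).
Proof.
elim: ss => [|s ss IH] /=; first by rewrite muln0.
by rewrite mulnDr size_cat leq_add //; case: ltnP => [/ltnW|]; rewrite ?muln1 ?muln0.
Qed.

Lemma mem_split (A : eqType) (x : A) s :
  x \in s -> exists s1 s2, s1 ++ x :: s2 = s.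
Proof. by case/splitPr => s1 s2; exists s1, s2. Qed.

Section Cover.
Variables (T : finType) (mu : T -> T) (g : {perm T}).
Hypotheses (muK : involutive mu) (gP : fpf_invol g).
Let gK := fpf_involK gP.
Let sg := turn mu g.

(* A block [z1; ...; zk] stands for the path z1, g z1, z2, g z2, ..., zk, g zk,
   whose edges alternate between [g] and [mu]. *)
Definition is_block (p : seq T) := (p != [::]) && sorted (frel (turn mu g)) p.

(** Exactly one end of each edge of [g] occurs in [flatten bs], so the paths partition the vertex
    set and keep all edges of [g]. *)
Definition is_cover (bs : seq (seq T)) :=
  all is_block bs &&
    perm_eq (flatten bs ++ map g (flatten bs)) (enum T).

Lemma perm_cover bs bs' : perm_eq bs bs' -> is_cover bs -> is_cover bs'.
Proof.
move=> bb /andP [ab pb]; apply/andP; split; first by rewrite -(perm_all _ bb).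
apply: perm_trans pb; rewrite perm_sym; apply: perm_cat.
  exact: perm_flatten.
by apply: perm_map; exact: perm_flatten.
Qed.

Lemma exists_cover : exists bs, is_cover bs.
Proof.
(* Each edge of [g] is a path by itself, oriented from its end of smaller rank. *)
pose s := [seq z <- enum T | enum_rank z < enum_rank (g z)].
exists [seq [:: z] | z <- s]; apply/andP; split.
  by apply/allP => _ /mapP [z _ ->].
have -> : flatten [seq [:: z] | z <- s] = s by rewrite flatten_map1 map_id.
apply: uniq_perm; [|exact: enum_uniq|].
  have us : uniq s by rewrite filter_uniq // enum_uniq.
  rewrite cat_uniq map_inj_uniq ?us; last exact: perm_inj.
  rewrite andbT; apply/hasPn => _ /mapP [z zs ->].
  move: zs; rewrite !mem_filter gK => /andP [zg _].
  by rewrite negb_and -leqNgt (ltnW zg).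
move=> z; rewrite mem_cat mem_enum inE mem_filter mem_enum andbT.
case: ltngtP => //= h.
  by apply/mapP; exists (g z); rewrite ?gK // mem_filter gK mem_enum h.
by have := fpf_invol_neq z gP; move/val_inj/enum_rank_inj: h => <-; rewrite eqxx.
Qed.

Lemma is_block_cat p q x0 : is_block p -> is_block q ->
  sg (last x0 p) = head x0 q -> is_block (p ++ q).
Proof.
case: p q => [//|x p] [//|y q] /andP [_ /= sp] /andP [_ /= sq] h.
by rewrite /is_block /= cat_path sp /= -/sg h eqxx sq.
Qed.

Lemma is_block_rev q : is_block q -> is_block (rev (map g q)).
Proof.
case/andP => q0 sq; apply/andP; split.
  by rewrite -size_eq0 size_rev size_map size_eq0.
rewrite rev_sorted sorted_map; apply: sub_sorted sq => x y /= /eqP <-.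
by rewrite /turn gK muK.
Qed.

Lemma cover_uniq bs : is_cover bs -> uniq (flatten bs ++ map g (flatten bs)).
Proof. by move=> /andP [_ /perm_uniq ->]; rewrite enum_uniq. Qed.

Lemma cover_size bs : is_cover bs -> (size (flatten bs)).*2 = #|T|.
Proof.
by move=> /andP [_ /perm_size]; rewrite size_cat size_map addnn -cardE.
Qed.

Lemma cover_disj bs z : is_cover bs ->
  z \in flatten bs -> g z \in flatten bs -> False.
Proof.
move=> /cover_uniq; rewrite cat_uniq => /and3P [_ /hasPn h _] zb gzb.
have /negP[//] : z \notin flatten bs.
by apply: h; apply/mapP; exists (g z); rewrite ?gK.
Qed.

Lemma block_prev p1 w p2 a : is_block (rcons p1 a ++ w :: p2) -> sg a = w.
Proof.
rewrite /is_block cat_rcons => /andP [_].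
by move=> /(cat_sorted2 (s := p1)) [_ /=] /andP [/eqP].
Qed.

Lemma cover_end bs p x0 : is_cover bs -> p \in bs ->
  (exists2 bs', is_cover bs' & size bs' < size bs) \/
  (sg (last x0 p) == g (last x0 p)) || (sg (last x0 p) == head x0 p).
Proof.
move=> cb pb.
have pr := perm_to_rem pb; set r := rem p bs in pr.
have {pb} cb := perm_cover pr cb.
have /andP [/andP [bp ar] pe] := cb.
set a := last x0 p; set w := sg a.
have ap : a \in p.
  by rewrite /a; case: (p) bp => // x q _ /=; exact: mem_last.
(* By injectivity of [turn], only [a] can precede [w] in a block. *)
have head_case q1 q2 : is_block (q1 ++ w :: q2) ->
    q1 = [::] \/ exists q1', q1 = rcons q1' a.
  case/lastP: q1 => [|q1 b]; first by left.
  by move/block_prev => /(turn_inj muK) ->; right; exists q1.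
(* A successor of [w'] would be [mu w = g a], the wrong end of the edge at [a]. *)
have last_case q1 w' q2 : is_block (q1 ++ w' :: q2) -> w = g w' ->
    q2 = [::] \/ g a \in q2.
  case: q2 => [|y q2]; first by left.
  rewrite -cat_rcons => /block_prev; rewrite /sg /turn => <- ww.
  by right; rewrite -ww /w /sg /turn muK mem_head.
have ua : uniq (flatten (p :: r)).
  by have := cover_uniq cb; rewrite cat_uniq => /andP [].
have ga : g a \notin flatten (p :: r).
  by apply/negP => ga; apply: (cover_disj cb _ ga); rewrite mem_cat ap.
have : w \in flatten (p :: r) ++ map g (flatten (p :: r)).
  by rewrite (perm_mem pe) mem_enum.
have inr q : q \in r -> exists2 r', perm_eq r (q :: r') & is_cover (p :: q :: r').
  move=> qr; exists (rem q r); first exact: perm_to_rem.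
  by apply: perm_cover cb; rewrite perm_cons perm_to_rem.
rewrite mem_cat => /orP [|/mapP [w' + ww]].
  rewrite /= mem_cat => /orP [wp|/flattenP [q qr wq]].
    right; apply/orP; right.
    have [q1 [q2 ep]] := mem_split wp.
    case: (head_case q1 q2) => [|e|[q1' e]]; first by rewrite ep.
      by rewrite -ep e.
    move: ua; rewrite /= cat_uniq => /andP [].
    rewrite -ep cat_uniq => /and3P [_ /hasPn h _] _.
    have aq : a \in w :: q2 by rewrite /a -ep last_cat /= mem_last.
    by have := h _ aq; rewrite e mem_rcons mem_head.
  have [r' rr c'] := inr _ qr.
  have bq : is_block q by apply: (allP ar).
  case/splitPr: wq qr rr c' bq => q1 q2 qr rr c' bq.
  case: (head_case _ _ bq) => [e|[q1' e]].
    left; exists ((p ++ q1 ++ w :: q2) :: r').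
      move: c' => /andP [/= /and3P [_ _ ar'] pe'].
      rewrite /is_cover /= ar' -(catA p) pe' !andbT (is_block_cat (x0 := x0)) //.
      by rewrite e /= -/a -/w.
    by rewrite (perm_size pr) /= (perm_size rr).
  have := cover_uniq c'; rewrite cat_uniq /= => /andP [+ _].
  rewrite cat_uniq => /and3P [_ /hasPn h _].
  have aq : a \in (q1 ++ w :: q2) ++ flatten r'.
    by rewrite !mem_cat e mem_rcons mem_head.
  by have := h _ aq; rewrite ap.
rewrite /= mem_cat => /orP [wp|/flattenP [q qr wq]].
  right; apply/orP; left.
  have [q1 [q2 ep]] := mem_split wp.
  case: (last_case q1 w' q2) => [|//|e|gq]; first by rewrite ep.
    by rewrite ww /a -ep e last_cat.
  by case/negP: ga; rewrite /= -ep !mem_cat inE gq !orbT.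
have [r' rr c'] := inr _ qr.
have bq : is_block q by apply: (allP ar).
case/splitPr: wq qr rr c' bq => q1 q2 qr rr c' bq.
case: (last_case _ _ _ bq ww) => [e|gq].
  left; exists ((p ++ rev (map g (q1 ++ w' :: q2))) :: r'); last first.
    by rewrite (perm_size pr) /= (perm_size rr).
  move: c' => /andP [/= /and3P [_ _ ar'] pe'].
  rewrite /is_cover /= ar' andbT (is_block_cat (x0 := x0)) //=.
  - move: pe'; move: (q1 ++ w' :: q2) => Q; apply: perm_trans.
    rewrite !map_cat map_rev -map_comp (eq_map (g := id) gK) map_id.
    by apply/seq.permP => b; rewrite !count_cat !count_rev; clear; lia.
  - exact: is_block_rev.
  - by rewrite e map_cat rev_cat /= -/a -/w ww.
case/negP: ga; rewrite /= mem_cat; apply/orP; right; apply/flattenP.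
by exists (q1 ++ w' :: q2) => //; rewrite mem_cat inE gq !orbT.
Qed.

Lemma cut_blocks l bs : 0 < l -> all is_block bs ->
  exists bs', [/\ flatten bs' = flatten bs, all is_block bs',
    all (fun p => size p <= l) bs' &
    l * size bs' <= l * size bs + size (flatten bs)].
Proof.
move=> l0; have cut1 p : is_block p ->
    exists bs', [/\ flatten bs' = p, all is_block bs',
      all (fun p => size p <= l) bs' & l * size bs' <= l + size p].
  have [m] := ubnP (size p); elim: m p => // m IH p pm bp.
  case: (leqP (size p) l) => pl.
    by exists [:: p]; rewrite /= cats0 bp pl muln1 leq_addr.
  have /andP [p0 sp] := bp.
  have bt : is_block (take l p).
    by rewrite /is_block take_sorted // andbT -size_eq0 size_take pl -lt0n.
  have bd : is_block (drop l p).
    by rewrite /is_block drop_sorted // andbT -size_eq0 size_drop -lt0n subn_gt0.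
  have [] := IH (drop l p) _ bd; first by rewrite size_drop; lia.
  move=> bs' [fb ab lb sb]; exists (take l p :: bs'); split.
  - by rewrite /= fb cat_take_drop.
  - by rewrite /= bt.
  - by rewrite /= lb size_take pl leqnn.
  - move: sb; rewrite size_drop /=; lia.
elim: bs => [|p bs IH] /=; first by exists [::]; split; rewrite //= muln0.
move=> /andP [/cut1 [b1 [f1 a1 l1 s1]] /IH [b2 [f2 a2 l2 s2]]].
exists (b1 ++ b2); rewrite flatten_cat f1 f2 !all_cat a1 a2 l1 l2; split => //.
by rewrite !size_cat; lia.
Qed.

(** Merge until no merge is possible. Each path then ends at a fixed point of [mu], closes a short
    alternating cycle, or has more than [l] entries. After multiplication by [l], the long paths
    cost at most [#|T| / 2], and cutting into pieces of size at most [l] costs the same. *)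
Lemma bounded_cover l : 0 < l ->
  exists bs, [/\ is_cover bs, all (fun p => size p <= l) bs &
    l * size bs <= l * (#|[set x | mu x == x]| + #|short_cycle_darts mu g l|)
                   + #|T|].
Proof.
move=> l0.
have [bs cb bend] : exists2 bs, is_cover bs & forall x0 p, p \in bs ->
    (sg (last x0 p) == g (last x0 p)) || (sg (last x0 p) == head x0 p).
  have [bs] := exists_cover; have [m] := ubnP (size bs).
  elim: m bs => // m IH bs bm cb.
  pose ok p := if p is z :: p' then
    (sg (last z p') == g (last z p')) || (sg (last z p') == z) else true.
  case: (boolP (all ok bs)) => [/allP okb|/allPn [p pb nok]].
    exists bs => // x0 p pb; have := okb _ pb.
    have /andP [/allP /(_ _ pb) + _] := cb.
    by case: p {pb}.
  case: p pb nok => // z p pb nok.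
  case: (cover_end z cb pb) => [[bs' c' s']|]; last by move/negP: nok.
  by apply: IH c'; apply: leq_trans s' _.
have /andP [ab pe] := cb.
have [bs' [fb ab' lb sb]] := cut_blocks l0 ab.
exists bs'; split => //; first by rewrite /is_cover ab' fb.
apply: leq_trans sb _; have sz := cover_size cb; rewrite -sz.
rewrite -addnn addnA leq_add2r.
pose a1 z := mu (g z) == g z; pose a2 z := z \in short_cycle_darts mu g l.
have le3 : size bs <= count (has a1) bs + count (has a2) bs
                    + count (fun p => l < size p) bs.
  have : all (fun p => [|| has a1 p, has a2 p | l < size p]) bs.
    apply/allP => p pb; have bp : is_block p by apply: (allP ab).
    have up : uniq (p ++ map g p).
      have := cover_uniq (perm_cover (perm_to_rem pb) cb).
      rewrite /= map_cat => /subseq_uniq; apply.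
      apply: cat_subseq; first exact: prefix_subseq.
      exact: prefix_subseq.
    case: p pb bp up => // z p pb bp up.
    case/orP: (bend z _ pb) => /= /eqP h.
      apply/orP; left; apply/(@hasP _ a1 (z :: p)).
      by exists (last z p); rewrite ?mem_last // /a1 -/(turn mu g _) -/sg h.
    case: (leqP (size (z :: p)) l) => pl; last by rewrite !orbT.
    apply/or3P; apply: Or32; apply/(@hasP _ a2 (z :: p)); exists z.
      exact: mem_head.
    rewrite /a2 inE; apply/existsP; exists (Ordinal (pl : size p < l)).
    move: bp => /andP [_ /= /fpathP [m e]].
    have em : size p = m by rewrite e size_traject.
    have et : traject sg z (size p).+1 = z :: p by rewrite /= em -e.
    suff : closes mu g z (size p).+1 by [].
    apply/andP; split; rewrite -/sg ?et //.
    by rewrite iterS em -(last_traject sg z m) -e h.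
  clear; elim: bs => //= p b IH /andP [+ /IH].
  by case: (has a1 p); case: (has a2 p); case: (l < size p) => //= _; lia.
have c1 : count (has a1) bs <= #|[set x | mu x == x]|.
  apply: leq_trans (count_has_flatten _ _) _.
  apply: (@leq_trans #|a1|).
    apply: count_le_card; have := cover_uniq cb; rewrite cat_uniq.
    by case/andP.
  rewrite -(card_imset a1 (@perm_inj _ g)); apply: subset_leq_card.
  by apply/subsetP => z /imsetP [y ya ->]; rewrite inE.
have c2 : count (has a2) bs <= #|short_cycle_darts mu g l|.
  apply: leq_trans (count_has_flatten _ _) _.
  apply: leq_trans (count_le_card _ _) _.
    by have := cover_uniq cb; rewrite cat_uniq => /andP [].
  by apply: subset_leq_card; apply/subsetP.
have c3 := mul_count_size_flatten l bs.
by have := leq_mul (leqnn l) le3; have := leq_mul (leqnn l) (leq_add c1 c2); lia.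
Qed.

End Cover.

(** * Inserting and linking paths *)

Section Arcs.
Variable T : eqType.
Implicit Types (c s t q : seq T) (E : rel T).

Definition arcs c := zip c (rot 1 c).

Lemma zip_rot i s t : size s = size t ->
  zip (rot i s) (rot i t) = rot i (zip s t).
Proof.
move=> st; have sz : size (take i s) = size (take i t) by rewrite !size_take st.
have sd : size (drop i s) = size (drop i t) by rewrite !size_drop st.
rewrite {1 2}/rot zip_cat // -{3}(cat_take_drop i s) -{3}(cat_take_drop i t).
rewrite zip_cat //; case: (leqP i (size s)) => [is_|/ltnW si].
  rewrite [X in _ = rot X _](_ : i = size (zip (take i s) (take i t))).
    by rewrite rot_size_cat.
  by rewrite size_zip -sz minnn size_takel.
by rewrite !drop_oversize -?st //= cats0 rot_oversize // size_zip -sz minnn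
  size_take_min geq_minl.
Qed.

Lemma mem_arcs_rot i c : arcs (rot i c) =i arcs c.
Proof.
by move=> u; rewrite /arcs rot_rot zip_rot ?size_rot // mem_rot.
Qed.

Lemma infix_arcs a b c : infix [:: a; b] c -> (a, b) \in arcs c.
Proof.
case/infixP => p [s ->]; rewrite -(mem_arcs_rot (size p)) rot_size_cat.
by rewrite /arcs rot1_cons mem_head.
Qed.

Lemma arcs_rot_to a b c : uniq c -> (a, b) \in arcs c -> a != b ->
  exists i s, rot i c = b :: rcons s a.
Proof.
move=> uc abc nab; have ac : a \in c.
  by move: (map_f fst abc); rewrite -/(unzip1 _) unzip1_zip ?size_rot.
case/rot_to: ac => i s rc.
move: abc; rewrite -(mem_arcs_rot i) rc /arcs rot1_cons.
have : uniq (a :: s) by rewrite -rc rot_uniq.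
case: s rc => [|b' s] rc /=.
  by rewrite mem_seq1 xpair_eqE eq_sym (negbTE nab) andbF.
move=> /and3P [as_ _ _]; rewrite in_cons => /orP [/eqP [->]|abs].
  by exists (rot_add c i 1), s; rewrite -rot_rot_add rc rot1_cons.
by move: (map_f fst abs); rewrite -/(unzip1 _) unzip1_zip ?size_rcons //= (negbTE as_).
Qed.

(** After a rotation the arc from [a] to [b] is the closing pair, and the path is appended there.
    The other arcs survive and remain available for further insertions. *)
Lemma absorb E c a b x q : uniq c -> path.cycle E c -> (a, b) \in arcs c -> a != b ->
  path E x q -> E a x -> E (last x q) b ->
  exists c', [/\ path.cycle E c', perm_eq c' (c ++ x :: q) &
    forall u, u \in arcs c -> u != (a, b) -> u \in arcs c'].
Proof.
move=> uc cc abc nab pq eax eqb.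
have [i [s rc]] := arcs_rot_to uc abc nab.
exists (b :: rcons s a ++ x :: q); split.
- move: cc; rewrite -(rot_cycle i) rc /= rcons_cat /= !cat_path !rcons_path.
  by rewrite last_rcons => /andP [-> _]; rewrite /= eax rcons_path pq eqb.
- by rewrite -cat_cons -rc perm_cat2r perm_rot.
- move=> u; rewrite -(mem_arcs_rot i) rc /arcs !rot1_cons.
  rewrite -rcons_cons zip_rcons ?size_rcons // mem_rcons in_cons.
  move=> /orP [/eqP ->|us _]; first by rewrite eqxx.
  rewrite /= rcons_cat cat_rcons -cat_cons zip_cat ?size_rcons //.
  by rewrite mem_cat us.
Qed.

End Arcs.

Section Pancyclic.
Variables (T : finType) (e : rel T) (g : {perm T}).
Hypotheses (esym : symmetric e) (gP : fpf_invol g).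
Let gK := fpf_involK gP.

Definition union_rel : rel T := fun x y => e x y || (g x == y).
Let E := union_rel.

Lemma union_rel_sym : symmetric E.
Proof. by move=> x y; rewrite /E /union_rel esym (can2_eq gK gK) eq_sym. Qed.

(* The edge {z, g z} can be replaced by any path from [x] to [y]. *)
Definition bridges x y z := e x z && e y (g z).

(** [Av] holds ends of edges of [g] lying on the cycle. An insertion uses up one such edge, hence at
    most two elements of [Av]: this is the factor 2. Whole paths are inserted as long as [k] allows;
    an initial segment of the next one gives the exact length. *)
Lemma grow_cycle c (Av : {set T}) (Qs : seq (seq T)) k :
  uniq (c ++ flatten Qs) -> path.cycle E c ->
  (forall z, z \in Av -> (z, g z) \in arcs c \/ (g z, z) \in arcs c) ->
  all (fun Q => (Q != [::]) && sorted E Q) Qs ->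
  (forall x y, 2 * size Qs <= #|[set z in Av | bridges x y z]|) ->
  k <= size (flatten Qs) ->
  exists c', [/\ uniq c', path.cycle E c' & size c' = size c + k].
Proof.
elim: Qs c Av k => [|Q Qs IH] c Av k.
  by rewrite /= cats0 leqn0 => uc cc _ _ _ /eqP ->; exists c; rewrite addn0.
move=> /= uc cc avP /andP [/andP [Q0 sQ] aQ] gd kQ.
case: (posnP k) => [->|k0].
  by exists c; rewrite addn0; split => //; move: uc; rewrite cat_uniq => /andP [].
have insert R : R != [::] -> sorted E R -> uniq (c ++ R) ->
    exists c' z, [/\ uniq c', path.cycle E c', perm_eq c' (c ++ R) &
     forall z', z' \in Av :\ z :\ g z ->
       (z', g z') \in arcs c' \/ (g z', z') \in arcs c'].
  case: R => // x R _ /= sR uR.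
  have [z] : exists z, z \in [set z in Av | bridges x (last x R) z].
    by apply/set0Pn; rewrite -card_gt0; apply: leq_trans (gd _ _).
  rewrite inE => /and3P [zA exz eyz].
  have uc' : uniq c by move: uR; rewrite cat_uniq => /andP [].
  have out z' a b : z' \in Av :\ z :\ g z -> (a, b) = (z, g z) \/ (a, b) = (g z, z) ->
      (z', g z') != (a, b) /\ (g z', z') != (a, b).
    rewrite !inE => /and3P [z1 z2 _].
    by case=> -[-> ->]; rewrite !xpair_eqE ?(negbTE z1) ?(negbTE z2) ?andbF.
  have fin a b c' : (a, b) = (z, g z) \/ (a, b) = (g z, z) ->
      (forall u, u \in arcs c -> u != (a, b) -> u \in arcs c') ->
      forall z', z' \in Av :\ z :\ g z ->
       (z', g z') \in arcs c' \/ (g z', z') \in arcs c'.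
    move=> ab keep z' zz; have [n1 n2] := out _ _ _ zz ab.
    have : z' \in Av by move: zz; rewrite !inE => /and3P [].
    by case/avP => h; [left|right]; apply: keep.
  case: (avP _ zA) => az.
    have [] := absorb uc' cc az _ sR _ _.
    - by rewrite eq_sym fpf_invol_neq.
    - by rewrite /E /union_rel esym exz.
    - by rewrite /E /union_rel eyz.
    move=> c' [cc' pc' keep]; exists c', z; split => //.
      by rewrite (perm_uniq pc').
    by apply: fin keep; left.
  (* Here the cycle runs from [g z] to [z], so the path is inserted backwards. *)
  have sR' : sorted E (rev (x :: R)).
    by rewrite rev_sorted (eq_sorted (e' := E)) // => ? ?; rewrite union_rel_sym.
  have eR : rev (x :: R) = last x R :: behead (rev (x :: R)).
    by rewrite lastI rev_rcons.
  have lR : last (last x R) (behead (rev (x :: R))) = x.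
    by rewrite -[RHS](last_rcons x (rev R) x) -rev_cons eR.
  rewrite eR /= in sR'.
  have [] := absorb uc' cc az _ sR' _ _.
  - exact: fpf_invol_neq.
  - by rewrite /E /union_rel esym eyz.
  - by rewrite lR /E /union_rel exz.
  move=> c' []; rewrite -eR => cc' pc' keep.
  have pc : perm_eq c' (c ++ x :: R).
    by apply: perm_trans pc' _; rewrite perm_cat2l perm_rev.
  exists c', z; split => //; first by rewrite (perm_uniq pc).
  by apply: fin keep; right.
case: (leqP k (size Q)) => kl.
  have [] := insert (take k Q).
  - by rewrite -size_eq0 size_takel // -lt0n.
  - exact: take_sorted.
  - move: uc; rewrite -{1}(cat_take_drop k Q) -catA catA cat_uniq.
    by case/andP.
  move=> c' [z [uc' cc' pc' _]]; exists c'; split => //.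
  by rewrite (perm_size pc') size_cat size_takel.
have [] := insert Q; rewrite ?Q0 //.
  by move: uc; rewrite catA cat_uniq => /andP [].
move=> c' [z [uc' cc' pc' av']].
have [] := IH c' (Av :\ z :\ g z) (k - size Q) _ cc' av' aQ.
- by move: uc; rewrite catA (perm_uniq (perm_cat pc' (perm_refl (flatten Qs)))).
- move=> x y; have := gd x y.
  set A1 := [set z in Av | _]; set A2 := [set z0 in Av :\ z :\ g z | _].
  have : #|A1| <= #|A2 :|: [set z; g z]|.
    apply: subset_leq_card; apply/subsetP => u; rewrite !inE.
    by case: (u == z); case: (u == g z); rewrite /= ?orbT ?orbF.
  have := (leq_card_setU A2 [set z; g z]).1; rewrite cards2.
  by case: (z != g z) => /=; lia.
- by move: kQ; rewrite size_cat; lia.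
move=> c'' [uc'' cc'' sc'']; exists c''; split => //.
by rewrite sc'' (perm_size pc') size_cat -addnA subnKC ?(ltnW kl).
Qed.

Definition expand (p : seq T) := flatten [seq [:: z; g z] | z <- p].

Lemma expand_cat p q : expand (p ++ q) = expand p ++ expand q.
Proof. by rewrite /expand map_cat flatten_cat. Qed.

Lemma perm_expand p : perm_eq (expand p) (p ++ map g p).
Proof.
elim: p => //= z p IH; rewrite perm_cons perm_sym -cat1s perm_catCA /=.
by rewrite perm_cons perm_sym.
Qed.

Lemma size_expand p : size (expand p) = (size p).*2.
Proof. by rewrite (perm_size (perm_expand p)) size_cat size_map addnn. Qed.

Lemma mem_expand p z : (z \in expand p) = (z \in p) || (g z \in p).
Proof.
rewrite (perm_mem (perm_expand p)) mem_cat; congr (_ || _).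
by rewrite -{1}(gK z) (mem_map perm_inj).
Qed.

Lemma flatten_expand bs : flatten (map expand bs) = expand (flatten bs).
Proof. by elim: bs => //= p bs ->; rewrite expand_cat. Qed.

Lemma infix_expand z p : z \in p -> infix [:: z; g z] (expand p).
Proof.
case/mem_split => p1 [p2 <-]; rewrite expand_cat /=.
by apply/infixP; exists (expand p1), (expand p2).
Qed.

(** Consecutive paths are joined through an edge of [g] inside [Bv]; [Z] records one end of each
    edge used. The infix clause ensures that the edges of [g] on the given paths can still receive
    insertions later. *)
Lemma link_paths (P0 : seq T) (Ps : seq (seq T)) (Bv : {set T}) :
  P0 != [::] -> sorted E P0 ->
  all (fun Q => (Q != [::]) && sorted E Q) Ps ->
  (forall z, (g z \in Bv) = (z \in Bv)) ->
  (forall x y, 2 * size Ps <= #|[set z in Bv | bridges x y z]|) ->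
  exists W Z, [/\ sorted E W, perm_eq W (P0 ++ flatten Ps ++ expand Z),
    uniq (expand Z), {subset Z <= Bv} & size Z = size Ps /\
    forall a b Q, Q \in P0 :: Ps -> infix [:: a; b] Q -> infix [:: a; b] W].
Proof.
elim: Ps P0 Bv => [|P1 Ps IH] P0 Bv n0 s0 aP gB gd.
  exists P0, [::]; split => //; first by rewrite /= !cats0.
  by split => // a b Q; rewrite inE => /eqP ->.
move: aP => /= /andP [/andP [n1 s1] aP].
case: P0 n0 s0 => // x0 P0 _ s0; case: P1 n1 s1 gd => // x1 P1 _ s1 gd.
have [z] : exists z, z \in [set z in Bv | bridges (last x0 P0) x1 z].
  by apply/set0Pn; rewrite -card_gt0; apply: leq_trans (gd _ _).
rewrite inE => /and3P [zB e0z e1z].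
have zg : z != g z by rewrite eq_sym fpf_invol_neq.
have [] := IH ((x0 :: P0) ++ [:: z; g z] ++ (x1 :: P1)) (Bv :\ z :\ g z) isT _ aP _ _.
- rewrite /= cat_path (s0 : path E x0 P0) /= (s1 : path E x1 P1) andbT.
  by apply/and3P; split; rewrite /E /union_rel ?e0z ?eqxx ?orbT // esym e1z.
- move=> y; rewrite !inE gB (inj_eq perm_inj) -{2}(gK z) (inj_eq perm_inj).
  by rewrite andbCA.
- move=> x y; have := gd x y.
  set A1 := [set z in Bv | _]; set A2 := [set z0 in Bv :\ z :\ g z | _].
  have : #|A1| <= #|A2 :|: [set z; g z]|.
    apply: subset_leq_card; apply/subsetP => u; rewrite !inE.
    by case: (u == z); case: (u == g z); rewrite /= ?orbT ?orbF.
  have := (leq_card_setU A2 [set z; g z]).1; rewrite cards2 zg /=.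
  by move=> /=; lia.
move=> W [Z [sW pW uZ ZB [sZ iW]]]; exists W, (z :: Z); split => //.
- apply: perm_trans pW _; apply/seq.permP => a.
  rewrite -[expand (z :: Z)]/(z :: g z :: expand Z).
  by rewrite !count_cat /= ?count_cat /=; clear; lia.
- rewrite /= uZ andbT inE negb_or zg /= !mem_expand !gK !negb_or.
  have nz : z \notin Z by apply/negP => /ZB; rewrite !inE eqxx andbF.
  have ngz : g z \notin Z by apply/negP => /ZB; rewrite !inE eqxx.
  by rewrite nz ngz.
- move=> y; rewrite inE => /orP [/eqP -> //|/ZB].
  by rewrite !inE => /and3P [].
split; first by rewrite /= sZ.
have iW0 := iW _ _ _ (mem_head _ _).
move=> a b Q; rewrite !inE => /or3P [/eqP ->|/eqP ->|QP] h.
- apply: iW0; exact: infix_catr.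
- by apply: iW0; apply: infix_catl; apply: infix_catl.
- by apply: iW h; rewrite inE QP orbT.
Qed.

End Pancyclic.

(** * Balanced splitting *)

Section RandomSplit.
Import Order.TTheory GRing.Theory Num.Theory.
Local Open Scope ring_scope.

Lemma bernoulli (x : rat) k : -1 <= x -> 1 + x *+ k <= (1 + x) ^+ k.
Proof.
move=> x1; elim: k => [|k IH]; first by rewrite mulr0n addr0 expr0.
have x0 : 0 <= 1 + x by lra.
rewrite exprS mulrS; apply: le_trans (ler_wpM2l x0 IH).
have : 0 <= x * (x *+ k) by rewrite mulrnAr mulrn_wge0 // -expr2 sqr_ge0.
by move: (_ *+ k) => u; lra.
Qed.

(** For [N > 1] the inverse of [1 - 1/N] is [1 + 1/(N-1)], and Bernoulli's inequality bounds its
    [N]-th power below by 2. *)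
Lemma expr_half (N : nat) : (0 < N)%N -> 2 * (1 - N%:R^-1) ^+ N <= 1 :> rat.
Proof.
case: N => // -[|N] _; first by rewrite invr1 subrr expr1 mulr0.
set M := N.+1; set p : rat := 1 - _.
have M0 : 0 < M%:R :> rat by rewrite ltr0n.
have p0 : 0 < p by rewrite subr_gt0 invf_lt1 ?ltr0n // ltr1n.
have pV : p^-1 = 1 + M%:R^-1.
  rewrite /p -natr1; move: (M%:R) M0 => x x0.
  by field; apply/andP; split; rewrite gt_eqF //; lra.
have : 2 <= (p^-1) ^+ M.+1.
  have x0 : 0 < (M%:R^-1 : rat) by rewrite invr_gt0.
  rewrite pV; apply: le_trans (bernoulli _ _); last by lra.
  by rewrite -[X in _ <= _ + X]mulr_natl -natr1 mulrDl mul1r divff ?gt_eqF //; lra.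
by rewrite exprVn => h; rewrite -ler_pdivlMr ?exprn_gt0 // div1r.
Qed.

(** Exponential moment method: the sum over all [A] of [p ^ (4 w(A))], where [w(A)] is the weight of
    [A], factors over [B] and is at most [2 ^ #|B| * p ^ D], while each light set contributes at
    least [2 ^ m * p ^ D]. *)
Lemma card_light_subsets (B : finType) (w : B -> nat) (L D : nat) :
  (0 < L)%N -> (forall b, w b <= L)%N -> (D <= \sum_b w b)%N ->
  (#|[set A : {set B} | 8 * (\sum_(b in A) w b) < D]| * 2 ^ (D %/ (16 * L))
    <= 2 ^ #|B|)%N.
Proof.
move=> L0 wL wD; set m := (D %/ _)%N.
pose N := (8 * L)%N; pose p : rat := 1 - N%:R^-1.
have N0 : (0 < N)%N by rewrite muln_gt0.
have p01 : 7 / 8 <= p <= 1.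
  rewrite /p gerBl invr_ge0 ler0n andbT.
  have : (N%:R^-1 : rat) <= 8^-1 by rewrite lef_pV2 ?posrE ?ltr0n // ler_nat leq_pmulr.
  lra.
have p0 : 0 < p by lra.
have p1 : p <= 1 by lra.
(* This is [1 + y ^ 4 <= 2 * y] for [y = p ^ w b]; the choice [N = 8 * L] and [w b <= L] give
   [7/8 <= y <= 1]. *)
have step b : 1 + p ^+ (4 * w b) <= 2 * p ^+ (w b).
  have y1 : p ^+ w b <= 1 by rewrite exprn_ile1 // ltW.
  have y78 : 7 / 8 <= p ^+ w b.
    have -> : p = 1 + (p - 1) by lra.
    apply: le_trans (bernoulli (w b) _); last by lra.
    have -> : p - 1 = - N%:R^-1 by rewrite /p addrC addKr.
    rewrite mulNrn -mulr_natl.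
    have : (w b)%:R / N%:R <= (8^-1 : rat); last lra.
    rewrite ler_pdivrMr ?ltr0n // /N natrM mulrA mulVf ?mul1r ?ler_nat //.
  rewrite mulnC exprM; move: (p ^+ w b) y1 y78 => y y1 y78.
  have -> : y ^+ 4 = y * y * y * y by rewrite !exprS expr0 mulr1 !mulrA.
  have h : 0 <= (1 - y) * (y * y * y + y * y + y - 1).
    apply: mulr_ge0; first by rewrite subr_ge0.
    have : 0 <= y * y * y by rewrite !mulr_ge0 //; lra.
    have : 49 / 64 <= y * y by nra.
    lra.
  have : 1 + y * y * y * y = 2 * y - (1 - y) * (y * y * y + y * y + y - 1) by ring.
  by move=> ->; rewrite gerBl.
have tot : \sum_(A : {set B}) p ^+ (4 * \sum_(b in A) w b) <= 2 ^+ #|B| * p ^+ D.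
  have -> : \sum_(A : {set B}) p ^+ (4 * \sum_(b in A) w b) =
      \prod_b (p ^+ (4 * w b) + 1).
    rewrite bigA_distr; apply: eq_bigr => A _.
    rewrite big_distrr /= expr_sum big_mkcond /=.
    by apply: eq_bigr => b _; case: ifP.
  apply: (@le_trans _ _ (\prod_b (2 * p ^+ w b))).
    apply: ler_prod => b _; rewrite addr_ge0 ?exprn_ge0 //=; last exact: ltW.
    by rewrite addrC step.
  rewrite big_split /= prodr_const -expr_sum ler_pM2l ?exprn_gt0 //.
  by apply: ler_wiXn2l => //; exact: ltW.
(* Lightness leaves [D / 2] to spare in the exponent, which makes room for [m] factors
   [p ^ N <= 1/2]. *)
have bad (A : {set B}) : (8 * (\sum_(b in A) w b) < D)%N ->
    2 ^+ m * p ^+ D <= p ^+ (4 * \sum_(b in A) w b).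
  move=> lt; set W := (\sum_(b in A) _)%N in lt *.
  have hD : (4 * W + N * m <= D)%N by have := leq_divM D (16 * L); rewrite -/m /N; nia.
  apply: (@le_trans _ _ (2 ^+ m * p ^+ (4 * W + N * m))).
    by rewrite ler_pM2l ?exprn_gt0 // ler_wiXn2l // ltW.
  rewrite exprD (exprM p N) mulrCA -exprMn -[X in _ <= X]mulr1 ler_pM2l ?exprn_gt0 //.
  apply: exprn_ile1; last exact: expr_half.
  by rewrite mulr_ge0 // exprn_ge0 // ltW.
rewrite -(ler_nat rat) natrM !natrX -(ler_pM2r (exprn_gt0 D p0)) -mulrA mulr_natl.
apply: le_trans tot; rewrite -sumr_const big_mkcond /=; apply: ler_sum => A _.
rewrite inE; case: ifP => [/bad //|_]; exact/exprn_ge0/ltW.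
Qed.

(** Union bound over [2 * #|I|] events: for some [i], the set or its complement is light.
    Complementation preserves the number of sets. *)
Lemma balanced_split (I B : finType) (w : I -> B -> nat) (L D : nat) :
  (0 < L)%N -> (forall i b, w i b <= L)%N -> (forall i, D <= \sum_b w i b)%N ->
  (2 * #|I| < 2 ^ (D %/ (16 * L)))%N ->
  exists A : {set B}, forall i, (D <= 8 * (\sum_(b in A) w i b))%N /\
    (D <= 8 * (\sum_(b in ~: A) w i b))%N.
Proof.
move=> L0 wL wD big; set m := (D %/ _)%N in big.
pose bad i := [set A : {set B} | (8 * (\sum_(b in A) w i b) < D)%N].
pose cobad i := [set ~: A | A in bad i].
have /set0Pn [A] : ~: (\bigcup_i (bad i :|: cobad i)) != set0.
  rewrite -card_gt0 cardsCs setCK subn_gt0 -cardsT -powersetT card_powerset cardsT.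
  rewrite -(ltn_pmul2r (expn_gt0 2 m)).
  apply: (@leq_ltn_trans ((\sum_i 2 * #|bad i|) * 2 ^ m)%N).
    rewrite leq_mul2r; apply/orP; right.
    elim/big_rec2: _ => [|i n S _ h]; first by rewrite cards0.
    apply: leq_trans (leq_card_setU _ _).1 _; apply: leq_add h.
    apply: leq_trans (leq_card_setU _ _).1 _.
    by rewrite mul2n -addnn leq_add2l leq_imset_card.
  apply: (@leq_ltn_trans (\sum_(i : I) 2 * 2 ^ #|B|)%N).
    rewrite big_distrl /=; apply: leq_sum => i _.
    by rewrite -mulnA leq_mul2l card_light_subsets.
  by rewrite sum_nat_const mulnA [(#|I| * 2)%N]mulnC mulnC ltn_pmul2l ?expn_gt0.
rewrite inE => /bigcupP nA; exists A => i; split; rewrite leqNgt; apply/negP => h.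
  by apply: nA; exists i => //; rewrite inE; apply/orP; left; rewrite inE.
apply: nA; exists i => //; rewrite inE; apply/orP; right.
by apply/imsetP; exists (~: A); rewrite ?setCK // inE.
Qed.

End RandomSplit.

(** * Cycles of all lengths *)

Section AllLengths.
Variables (T : finType) (e : rel T) (g : {perm T}) (mu : T -> T).
Hypotheses (esym : symmetric e) (gP : fpf_invol g).
Hypothesis (mu_edge : forall x, mu x != x -> e x (mu x)).
Let gK := fpf_involK gP.
Let E := union_rel e g.

(** Deleting one entry splits a block into at most two, so each deletion adds at most one block. *)
Lemma remove_darts (P : pred T) bs : all (is_block mu g) bs ->
  exists Qs, [/\ all (is_block mu g) Qs,
    flatten Qs = [seq z <- flatten bs | ~~ P z] &
    size Qs <= size bs + count P (flatten bs)].
Proof.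
(* The surviving runs number at most the deleted entries, plus one if the first entry survives; this
   form passes through the induction. *)
have one p : is_block mu g p -> exists Qs, [/\ all (is_block mu g) Qs,
    flatten Qs = [seq z <- p | ~~ P z] &
    size Qs <= (if p is z :: _ then ~~ P z : nat else 0) + count P p].
  elim: p => // z [|y p] IH bp.
    case Pz: (P z); first by exists [::]; rewrite /= Pz.
    by exists [:: [:: z]]; rewrite /= Pz.
  have [Qs [aQ fQ sQ]] : exists Qs, [/\ all (is_block mu g) Qs,
      flatten Qs = [seq z <- y :: p | ~~ P z] &
      size Qs <= (~~ P y : nat) + count P (y :: p)].
    by apply: IH; move: bp; rewrite /is_block /= => /andP [].
  case Pz: (P z).
    exists Qs; split => //; first by rewrite fQ /= Pz.
    by move: sQ; rewrite /= Pz; case: (P y) => /=; lia.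
  case Py: (P y).
    exists ([:: z] :: Qs); split => //; first by rewrite /= fQ /= Pz.
    by move: sQ; rewrite /= Pz Py /=; lia.
  move: fQ; rewrite /= Py /=; case: Qs aQ sQ => [//|[|y' q] Qs] //= /andP [bq aQ] sQ.
  move=> -[ey fQ]; exists ((z :: y' :: q) :: Qs); split => /=.
  - rewrite aQ andbT; move: bp bq; rewrite /is_block /= ey.
    by move=> /andP [-> _] ->.
  - by rewrite Pz ey fQ.
  - by move: sQ; rewrite Pz Py.
elim: bs => [|p bs IH] /=; first by exists [::].
move=> /andP [/one [Q1 [a1 f1 s1]] /IH [Q2 [a2 f2 s2]]].
exists (Q1 ++ Q2); rewrite all_cat a1 a2 flatten_cat f1 f2 filter_cat; split=> //.
rewrite size_cat count_cat; case: p {f1} s1 => [|z p]; first by rewrite /=; lia.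
by case: (~~ P z) => /=; lia.
Qed.

(** The disjointness condition rules out fixed points of [mu] between consecutive entries, so every
    [mu]-step is an edge of [e]. *)
Lemma expand_sorted p : is_block mu g p -> {in p &, forall x y, x != g y} ->
  (expand g p != [::]) && sorted E (expand g p).
Proof.
case: p => // z p /andP [_ sp] dis; apply/andP; split=> //.
elim: p z sp dis => [|y p IH] z; first by rewrite /= /E /union_rel eqxx orbT.
move=> /= /andP [/eqP zy py] dis.
have := IH y py; rewrite /= => -> ; last first.
  by move=> u v us vs; apply: dis; rewrite inE ?us ?vs orbT.
rewrite /E /union_rel eqxx orbT /= andbT -zy.
apply/orP; left; apply: mu_edge; rewrite -/(turn mu g z) zy.
by apply: dis; rewrite !inE ?eqxx ?orbT.
Qed.

Section Split.
Variables As Bs : seq (seq T).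
Hypothesis cov : is_cover mu g (As ++ Bs).
Let fA := flatten As.
Let fB := flatten Bs.
Let eA := expand g fA.
Let eB := expand g fB.

Lemma split_perm : perm_eq (eA ++ eB) (enum T).
Proof.
have /andP [_] := cov; apply: perm_trans.
by rewrite -expand_cat -flatten_cat perm_expand.
Qed.

Lemma split_uniq : uniq (eA ++ eB).
Proof. by rewrite (perm_uniq split_perm) enum_uniq. Qed.

Lemma split_disj z : z \in eA -> z \in eB -> False.
Proof.
move=> zA zB; move: split_uniq; rewrite cat_uniq => /and3P [_ /hasPn h _].
by have := h _ zB; rewrite zA.
Qed.

Lemma mem_expandg s z : (g z \in expand g s) = (z \in expand g s).
Proof. by rewrite !mem_expand // gK orbC. Qed.

Lemma expand_subset s s' : {subset s <= expand g s'} ->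
  {subset expand g s <= expand g s'}.
Proof.
move=> ss z; rewrite mem_expand // => /orP [/ss //|/ss].
by rewrite mem_expandg.
Qed.

Lemma card_bridges (s : seq T) x y : uniq s ->
  #|[set z in [set z in s] | bridges e g x y z]| = count (bridges e g x y) s.
Proof.
move=> us; rewrite -size_filter -(card_uniqP _) ?filter_uniq //.
by apply: eq_card => z; rewrite !inE mem_filter andbC.
Qed.

Lemma all_lengths k :
  (forall x y, 0 < count (bridges e g x y) eA) ->
  (forall x y, 4 * (size As + size Bs) <= count (bridges e g x y) eA) ->
  (forall x y, 4 * (size As + size Bs) <= count (bridges e g x y) eB) ->
  3 <= k <= #|T| ->
  exists c, [/\ uniq c, path.cycle E c & size c = k].
Proof.
move=> A0 cA cB /andP [k3 kT].
have /andP [] := cov; rewrite all_cat => /andP [aA aB] pe.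
have := split_uniq; rewrite cat_uniq => /and3P [uA _ uB].
have dis p : p \in As ++ Bs -> {in p &, forall x y, x != g y}.
  move=> pb x y xp yp; apply/eqP => xy.
  apply: (@cover_disj _ _ _ gP _ y cov); first by apply/flattenP; exists p.
  by rewrite -xy; apply/flattenP; exists p.
have blkP p : p \in As ++ Bs -> is_block mu g p ->
    (expand g p != [::]) && sorted E (expand g p).
  by move=> pb bp; apply: expand_sorted => //; exact: dis.
have [x00 _] : exists x : T, true.
  have /card_gt0P [x _] : 0 < #|T| by apply: leq_trans kT; apply: leq_trans k3.
  by exists x.
have [P0 [As' eAs]] : exists P0 As', As = P0 :: As'.
  case EA: As => [|P0 As']; last by exists P0, As'.
  by have := A0 x00 x00; rewrite /eA /fA EA.
pose Bv := [set z in eB].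
have gB z : (g z \in Bv) = (z \in Bv) by rewrite !inE mem_expandg.
have /andP [P0n P0s] : (expand g P0 != [::]) && sorted E (expand g P0).
  by apply: blkP; [rewrite eAs inE eqxx|move: aA; rewrite eAs => /andP []].
have aPs : all (fun Q => (Q != [::]) && sorted E Q) (map (expand g) As').
  apply/allP => _ /mapP [p pA ->].
  have pAs : p \in As by rewrite eAs inE pA orbT.
  by apply: blkP; [rewrite mem_cat pAs|apply: (allP aA)].
have sAs : size As = (size As').+1 by rewrite eAs.
have [|W [Z [sW pW uZ ZB [sZ iW]]]] := link_paths esym gP P0n P0s aPs gB.
  move=> x y; rewrite card_bridges // size_map; move: (cB x y); rewrite sAs.
  by clear; lia.
have {}pW : perm_eq W (eA ++ expand g Z).
  by rewrite (perm_trans pW) // catA flatten_expand -expand_cat /eA /fA eAs.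
have {}ZB : {subset expand g Z <= eB}.
  by apply: expand_subset => z /ZB; rewrite inE.
rewrite size_map in sZ.
have uW : uniq W.
  rewrite (perm_uniq pW) cat_uniq uA uZ andbT /=; apply/hasPn => z /ZB zB.
  by apply/negP => /split_disj; apply.
(* Linking used [2 * (size As - 1)] vertices of B, fewer than the bridging ends available there. *)
have free x y : exists z, [/\ bridges e g x y z, z \in eB, z \notin W & g z \notin W].
  have [z] : exists z, (z \in [set z in Bv | bridges e g x y z]) &&
      (z \notin expand g Z).
    apply/existsP; apply: contraT; rewrite negb_exists => /forallP sub.
    have : #|[set z in Bv | bridges e g x y z]| <= size (expand g Z).
      rewrite -(card_uniqP uZ); apply: subset_leq_card; apply/subsetP => z zs.
      by have := sub z; rewrite zs /= negbK.
    by rewrite card_bridges // size_expand sZ; move: (cB x y); rewrite sAs; clear; lia.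
  rewrite !inE => /andP [/andP [zB bz] zZ]; exists z.
  rewrite !(perm_mem pW) !mem_cat !mem_expandg (negbTE zZ) orbF.
  by split => //; apply/negP => /split_disj; apply.
have close x q z : sorted E (x :: q) -> bridges e g (last x q) x z ->
    path.cycle E (x :: q ++ [:: z; g z]).
  move=> /= sq /andP [b1 b2]; rewrite rcons_cat cat_path sq /=.
  by apply/and4P; split; rewrite // /E /union_rel ?b1 ?eqxx ?orbT // esym b2.
have zg z : (z == g z) = false by rewrite eq_sym; exact/negbTE/fpf_invol_neq.
have W0 : 0 < size W.
  rewrite (perm_size pW) size_cat; apply: leq_trans (A0 x00 x00) _.
  exact: leq_trans (count_size _ _) (leq_addr _ _).
(* Short lengths: the first [k - 2] vertices of [W], nonempty as [k >= 3], are closed by both ends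
   of a free edge. *)
case: (leqP k (size W + 2)) => kW.
  have st : size (take (k - 2) W) = k - 2.
    by rewrite size_takel //; move: kW; clear; lia.
  have st1 : sorted E (take (k - 2) W) by apply: take_sorted.
  have ut : uniq (take (k - 2) W) by apply: take_uniq.
  have sub : {subset take (k - 2) W <= W} by exact: mem_take.
  case: (take _ _) st st1 ut sub => [st|x q st st1 ut sub].
    by move: k3 st => /=; clear; lia.
  have [z [bz _ zW gzW]] := free (last x q) x.
  exists (x :: q ++ [:: z; g z]); split; last 2 first.
  - exact: close.
  - by rewrite /= size_cat /=; move: k3 st => /=; clear; lia.
  rewrite -cat_cons cat_uniq ut [has _ _]/= [uniq [:: _; _]]/= mem_seq1 zg.
  by rewrite orbF negb_or /= andbT; apply/andP; split; apply/negP => /sub; apply/negP.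
(* Greater lengths: all of [W] is closed into [c0], then enlarged by what is left of B. *)
case EW: W W0 => [//|x W'] _.
have [z0 [bz z0B z0W gz0W]] := free (last x W') x.
pose Z1 := z0 :: Z; pose c0 := x :: W' ++ [:: z0; g z0].
have pc0 : perm_eq c0 (eA ++ expand g Z1).
  rewrite /c0 -cat_cons -EW; apply/seq.permP => a.
  rewrite -[expand g Z1]/(z0 :: g z0 :: expand g Z).
  by rewrite count_cat (seq.permP pW) !count_cat /=; clear; lia.
(* The edges of B already on [c0] are cut out of the paths of B. *)
have [Qs [aQ fQ sQ]] := remove_darts (fun d => d \in expand g Z1) aB.
have Z1B : {subset expand g Z1 <= eB}.
  apply: expand_subset => z; rewrite inE => /orP [/eqP -> //|zZ].
  by apply: ZB; rewrite mem_expand // zZ.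
have uZ1 : uniq (expand g Z1).
  have : uniq c0.
    rewrite /c0 -cat_cons -EW cat_uniq uW /= mem_seq1 zg orbF.
    by rewrite negb_or z0W gz0W.
  by rewrite (perm_uniq pc0) cat_uniq => /and3P [].
have eQ z : (z \in expand g (flatten Qs)) = (z \in eB) && (z \notin expand g Z1).
  rewrite mem_expand // fQ !mem_filter /= mem_expandg /eB (mem_expand gP fB).
  by rewrite -andb_orr andbC.
have pB : perm_eq (expand g Z1 ++ expand g (flatten Qs)) eB.
  apply: uniq_perm => //.
    rewrite cat_uniq uZ1 /=; apply/andP; split.
      by apply/hasPn => z; rewrite eQ => /andP [].
    rewrite (perm_uniq (perm_expand _ _)) fQ.
    move: uB; rewrite (perm_uniq (perm_expand _ _)); apply: subseq_uniq.
    by rewrite cat_subseq ?map_subseq // filter_subseq.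
  move=> z; rewrite mem_cat eQ; case: (boolP (z \in expand g Z1)) => [/Z1B -> //|_].
  by rewrite andbT.
have ptot : perm_eq (c0 ++ flatten (map (expand g) Qs)) (enum T).
  apply: perm_trans split_perm; rewrite flatten_expand.
  apply: (@perm_trans _ ((eA ++ expand g Z1) ++ expand g (flatten Qs))).
    by rewrite perm_cat2r.
  by rewrite -catA perm_cat2l.
have stot : size c0 + size (flatten (map (expand g) Qs)) = #|T|.
  by rewrite -size_cat (perm_size ptot) -cardE.
have sc0 : size c0 = size W + 2 by rewrite EW /c0 /= size_cat /=; clear; lia.
have [||||||c [uc cc sc]] := @grow_cycle _ e g esym gP c0 [set z in eA]
    (map (expand g) Qs) (k - size c0).
- by rewrite (perm_uniq ptot) enum_uniq.
- by apply: close => //; rewrite -EW.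
- move=> z; rewrite inE mem_expand //.
  have key y : y \in fA -> (y, g y) \in arcs c0.
    case/flattenP => p pA yp; apply: infix_arcs; rewrite /c0 -cat_cons -EW.
    apply: infix_catr; apply: (iW _ _ (expand g p)); last exact: infix_expand.
    by rewrite -map_cons -eAs map_f.
  by move=> /orP [/key|/key]; [left|right; rewrite -{2}(gK z)].
- apply/allP => _ /mapP [q qQ ->]; apply: expand_sorted; first exact: (allP aQ).
  have qB u : u \in q -> u \in fB.
    move=> uq; have : u \in flatten Qs by apply/flattenP; exists q.
    by rewrite fQ mem_filter => /andP [].
  move=> u v /qB uB' /qB vB; apply/eqP => uv.
  apply: (@cover_disj _ _ _ gP _ v cov); rewrite flatten_cat mem_cat ?vB ?orbT //.
  by rewrite -uv uB' orbT.
(* At most [2 * size As] entries were deleted, so there are at most [size Bs + 2 * size As] paths to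
   insert; doubling this gives the bound with factor 4. *)
- move=> y y'; rewrite card_bridges // size_map.
  have := cA y y'.
  have : count (fun d => d \in expand g Z1) fB <= size (expand g Z1).
    rewrite -(card_uniqP uZ1); apply: count_le_card.
    by move: uB; rewrite (perm_uniq (perm_expand _ _)) cat_uniq => /andP [].
  by rewrite -/fB in sQ; move: sQ; rewrite size_expand /= sZ sAs; clear; lia.
- by rewrite leq_subLR stot.
by exists c; split=> //; rewrite sc subnKC // sc0 ltnW.
Qed.
End Split.

Lemma all_lengths_of_cover bs D l k : is_cover mu g bs ->
  0 < l -> all (fun p => size p <= l) bs -> 0 < D -> 32 * size bs <= D ->
  (forall x y, D <= #|[set z | bridges e g x y z]|) ->
  2 * (#|T| * #|T|) < 2 ^ (D %/ (32 * l)) -> 3 <= k <= #|T| ->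
  exists c, [/\ uniq c, path.cycle E c & size c = k].
Proof.
move=> cb l0 lb D0 bD gd big kT.
pose w (u : T * T) (b : 'I_(size bs)) :=
  count (bridges e g u.1 u.2) (expand g (nth [::] bs b)).
pose sel (A : {set 'I_(size bs)}) := [seq nth [::] bs b | b : 'I__ <- enum A].
have wsel (A : {set _}) u : \sum_(b in A) w u b =
    count (bridges e g u.1 u.2) (expand g (flatten (sel A))).
  rewrite -flatten_expand count_flatten sumnE /sel -!map_comp big_map big_enum /=.
  by apply: eq_bigl.
have psel A : perm_eq (sel A ++ sel (~: A)) bs.
  rewrite /sel -map_cat.
  have eb : [seq nth [::] bs (val b) | b <- enum 'I_(size bs)] = bs.
    by rewrite (map_comp (nth [::] bs) val) val_enum_ord -/(mkseq _ _) mkseq_nth.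
  rewrite -[X in perm_eq _ X]eb; apply: perm_map; apply: uniq_perm.
  - rewrite cat_uniq !enum_uniq /= andbT; apply/hasPn => b.
    by rewrite !mem_enum inE.
  - exact: enum_uniq.
  - by move=> b; rewrite mem_cat !mem_enum inE orbN.
have csel A : is_cover mu g (sel A ++ sel (~: A)).
  by apply: perm_cover cb; rewrite perm_sym.
(* A path of at most [l] entries has at most [2 * l] vertices, which bounds its weight; the indices
   are the pairs of vertices. *)
have [|u b|u||A hA] := @balanced_split (T * T)%type 'I_(size bs) w (2 * l) D.
- by rewrite muln_gt0.
- apply: leq_trans (count_size _ _) _; rewrite size_expand -mul2n leq_mul2l /=.
  by apply: (allP lb); apply: mem_nth.
- apply: leq_trans (gd u.1 u.2) _; rewrite cardsE cardE /enum_mem size_filter -enumT.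
  have /andP [_ pe] := cb.
  rewrite -(seq.permP (perm_trans (perm_expand g _) pe)) -flatten_expand.
  by rewrite count_flatten sumnE !big_map (big_nth [::]) big_mkord.
- by rewrite card_prod (mulnA 16).
have sz : size (sel A) + size (sel (~: A)) = size bs.
  by rewrite -size_cat (perm_size (psel A)).
apply: (@all_lengths (sel A) (sel (~: A)) (csel A)) => // x y.
- by have [+ _] := hA (x, y); rewrite wsel /=; lia.
- by have [+ _] := hA (x, y); rewrite wsel sz /=; lia.
- by have [_] := hA (x, y); rewrite wsel sz /=; lia.
Qed.

End AllLengths.

(** * Perfect matchings as involutions *)

Section Matchings.
Variable T : finType.
Implicit Types (M H : {set {set T}}) (g : {perm T}) (x y : T).

(** Unmatched vertices are sent to themselves, which makes a matching a total involution. *)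
Definition mate M x := odflt x [pick y | (y != x) && ([set x; y] \in M)].

Lemma matching_uniq M x y z : matching M -> y != x ->
  [set x; y] \in M -> [set x; z] \in M -> y = z.
Proof.
move=> /andP [_ /trivIsetP tM] yx xy xz.
case: (eqVneq [set x; y] [set x; z]) => [exyz|ne].
  have : y \in [set x; z] by rewrite -exyz set22.
  by rewrite !inE (negbTE yx) => /eqP.
by have := tM _ _ xy xz ne; rewrite disjoints_subset => /subsetP /(_ x);
  rewrite !inE eqxx => /(_ isT).
Qed.

Lemma mateE M x y : matching M -> y != x -> [set x; y] \in M -> mate M x = y.
Proof.
move=> mM yx xy; rewrite /mate; case: pickP => [z /andP [zx xz]|/(_ y)] /=.
  exact: (matching_uniq mM zx xz xy).
by rewrite yx xy.
Qed.

Lemma mate_edge M x : mate M x != x -> [set x; mate M x] \in M.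
Proof. by rewrite /mate; case: pickP => [z /andP []|_] //=; rewrite eqxx. Qed.

Lemma mateK M : matching M -> involutive (mate M).
Proof.
move=> mM x; case: (eqVneq (mate M x) x) => [xx|nx]; first by rewrite !xx.
by apply: mateE => //; rewrite 1?eq_sym // setUC mate_edge.
Qed.

Lemma simple_edgeP H (A : {set T}) x : simple_graph H -> A \in H -> x \in A ->
  exists2 y, y != x & A = [set x; y].
Proof.
move=> /forall_inP sH AH xA; have /cards2P [a [b [ab eA]]] := sH _ AH.
move: xA; rewrite eA !inE => /orP [] /eqP ->; first by exists b; rewrite 1?eq_sym.
by exists a => //; rewrite setUC.
Qed.

Lemma mate_cover M x : matching M -> x \in cover M -> mate M x != x.
Proof.
move=> mM /bigcupP [A AM xA]; have /andP [sM _] := mM.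
have [y yx eA] := simple_edgeP sM AM xA.
by rewrite (mateE mM yx) // -eA.
Qed.

Lemma card_mate_fix M : matching M ->
  #|[set x | mate M x == x]| + #|cover M| <= #|T|.
Proof.
move=> mM; rewrite -(cardsC (cover M)) addnC leq_add2l.
apply: subset_leq_card; apply/subsetP => x; rewrite !inE.
by apply: contraL => /(mate_cover mM).
Qed.

Definition edges g := [set [set x; g x] | x : T].

Lemma mem_edges g x y : fpf_invol g -> ([set x; y] \in edges g) = (g x == y).
Proof.
move=> gP; apply/imsetP/eqP => [[z _ exy]|<-]; last by exists x.
have xy : x != y.
  have := cards2 x y; rewrite exy cards2 eq_sym fpf_invol_neq //.
  by case: (x != y).
have : x \in [set z; g z] by rewrite -exy set21.
have : y \in [set z; g z] by rewrite -exy set22.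
rewrite !inE => /orP [] /eqP ey /orP [] /eqP ex; move: xy; rewrite ex ey ?eqxx //.
by rewrite (fpf_involK gP).
Qed.

Lemma edges_pm g : fpf_invol g -> perfect_matching (edges g).
Proof.
move=> gP; apply/andP; split; last first.
  apply/eqP/setP => x; rewrite inE; apply/bigcupP.
  by exists [set x; g x]; rewrite ?set21 // mem_edges.
apply/andP; split.
  apply/forall_inP => _ /imsetP [x _ ->].
  by rewrite cards2 (eq_sym x) fpf_invol_neq.
apply/trivIsetP => _ _ /imsetP [x _ ->] /imsetP [y _ ->].
apply: contraR; rewrite -setI_eq0 => /set0Pn [z]; rewrite !inE => /andP [].
have ez u : z = u \/ z = g u -> [set u; g u] = [set z; g z].
  by case=> ->; rewrite // (fpf_involK gP) setUC.
have orE u : (z == u) || (z == g u) -> z = u \/ z = g u.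
  by move=> /orP [] /eqP; [left|right].
by move=> /orE /ez -> /orE /ez ->.
Qed.

Lemma edges_inj : {in fpf_invols T &, injective edges}.
Proof.
move=> g h; rewrite !inE => gP hP eE; apply/permP => x; apply/esym/eqP.
by rewrite -mem_edges // -eE mem_edges.
Qed.

Lemma edges_onto M : perfect_matching M -> exists2 g, fpf_invol g & edges g = M.
Proof.
move=> /andP [mM /eqP cM].
pose g := perm (inv_inj (mateK mM)).
have gE x : g x = mate M x by rewrite permE.
have gn x : g x != x by rewrite gE mate_cover // cM inE.
exists g.
  by apply/forallP => x; rewrite gn !gE (mateK mM) eqxx.
apply/setP => A; apply/imsetP/idP => [[x _ ->]|AM].
  by rewrite gE mate_edge // -gE.
have /andP [sM _] := mM; have /forall_inP s2 := sM.
have /card_gt0P [x xA] : 0 < #|A| by rewrite (eqP (s2 _ AM)).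
have [y yx eA] := simple_edgeP sM AM xA.
by exists x => //; rewrite gE (mateE mM yx) // -eA.
Qed.

(** [edges] is a bijection from fixed-point-free involutions to perfect matchings, so the switching
    counts become probabilities. *)
Lemma card_pm (P : pred {set {set T}}) :
  #|[set M | perfect_matching M && P M]| = #|[set g | fpf_invol g && P (edges g)]|.
Proof.
rewrite -(card_in_imset (f := edges)); last first.
  move=> g h; rewrite !inE => /andP [gP _] /andP [hP _].
  by apply: edges_inj; rewrite inE.
apply: eq_card => M; rewrite inE; apply/andP/imsetP => [[pM PM]|[g + ->]].
  have [g gP eg] := edges_onto pM; exists g => //.
  by rewrite inE gP eg.
by rewrite inE => /andP [gP Pg]; rewrite edges_pm.
Qed.

Lemma adj_union H g : fpf_invol g ->
  adj (H :|: edges g) =2 union_rel (adj H) g.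
Proof. by move=> gP x y; rewrite /adj inE mem_edges. Qed.

Lemma adj_sym H : symmetric (adj H).
Proof. by move=> x y; rewrite /adj setUC. Qed.

Lemma degree_nbr H x : simple_graph H -> degree H x <= #|[set y | adj H x y]|.
Proof.
move=> sH; apply: leq_trans (leq_imset_card (fun y => [set x; y]) _).
apply: subset_leq_card; apply/subsetP => A; rewrite inE => /andP [AH xA].
have [y _ eA] := simple_edgeP sH AH xA.
by apply/imsetP; exists y; rewrite // inE /adj -eA.
Qed.

Lemma min_degree_le H x : min_degree H <= degree H x.
Proof.
rewrite /min_degree; have : x \in index_enum T by rewrite mem_index_enum.
elim: (index_enum T) => // y s IH; rewrite inE big_cons geq_min.
by move=> /orP [/eqP <-|/IH ->]; rewrite ?leqnn ?orbT.
Qed.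

End Matchings.

(** * Counting the bad matchings for a fixed graph *)

Section FiniteBound.
Variables (T : finType) (H : {set {set T}}) (M : {set {set T}}).
Hypotheses (H_simple : simple_graph H) (M_matching : matching M) (MH : M \subset H).
Let n := #|T|.
Let d := min_degree H.
Let mu := mate M.
Let nbr x := [set y | adj H x y].

Lemma pancyclic_union g D l : fpf_invol g -> 0 < D -> 0 < l ->
  128 * (n - #|cover M|) <= D -> 128 * #|short_cycle_darts mu g l| <= D ->
  64 * n <= l * D -> 2 * (n * n) < 2 ^ (D %/ (32 * l)) ->
  (forall x y, D <= #|hits (nbr x) (nbr y) g|) ->
  pancyclic (H :|: edges g).
Proof.
move=> gP D0 l0 uD sD lD big hD; apply/forallP => k; apply/implyP => k3.
have mu_edge x : mu x != x -> adj H x (mu x).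
  by move=> /mate_edge; exact: (subsetP MH).
have [bs [cb lb sb]] := bounded_cover (mateK M_matching) gP l0.
have fixM := card_mate_fix M_matching.
(* Unmatched vertices and short cycles contribute at most [D / 4] each, the term [n / l] at most
   [D / 2]. *)
have sbs : 32 * size bs <= D.
  rewrite -(leq_pmul2l l0); move: sb uD sD lD fixM; rewrite -/mu -/n.
  move: (#|[set x | _]|) (#|cover M|) (#|short_cycle_darts mu g l|) (size bs).
  move=> a b c s.
  clear; nia.
have [x y||c [uc cc sc]] := @all_lengths_of_cover T (adj H) g mu (@adj_sym _ H) gP
    mu_edge bs D l k cb l0 lb D0 sbs _ big.
- apply: leq_trans (hD x y) _; apply: subset_leq_card; apply/subsetP => z.
  by rewrite !inE.
- by rewrite k3 -ltnS ltn_ord.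
have /eqP sck := sc.
apply/existsP; exists (Tuple sck); rewrite /ucycleb /= uc andbT.
by rewrite (eq_cycle (adj_union H gP)).
Qed.

(** Failure has two causes: some pair of vertices has few bridges ([b1], by the lower tail), or
    there are many short cycles ([b2], by Markov's inequality). *)
Lemma card_not_pancyclic D l : 0 < D -> 0 < l -> 4 <= d ->
  32 * D * n <= d ^ 2 -> 128 * (n - #|cover M|) <= D -> 64 * n <= l * D ->
  2 * (n * n) < 2 ^ (D %/ (32 * l)) -> 4 * l <= n ->
  exists b1 b2, [/\
    #|[set g | fpf_invol g && ~~ pancyclic (H :|: edges g)]| <= b1 + b2,
    2 ^ D * b1 <= n * n * #|fpf_invols T| &
    D * b2 <= 256 * l * #|fpf_invols T|].
Proof.
move=> D0 l0 d4 dD uD lD big ln.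
pose B1 := \bigcup_(u : T * T) few_hits (nbr u.1) (nbr u.2) D.
pose B2 := [set g | fpf_invol g && (D < 128 * #|short_cycle_darts mu g l|)].
exists #|B1|, #|B2|; split.
- apply: leq_trans (leq_card_setU B1 B2).1; apply: subset_leq_card.
  apply/subsetP => g; rewrite !inE => /andP [gP ng].
  case: leqP => [sD|]; last by rewrite gP orbT.
  rewrite andbF orbF; apply: contraR ng => /bigcupP nB.
  apply: (pancyclic_union gP D0 l0) => // x y.
  rewrite leqNgt; apply/negP => lt; apply: nB; exists (x, y) => //.
  by rewrite inE gP ltnW.
- have cB1 : #|B1| <= \sum_(u : T * T) #|few_hits (nbr u.1) (nbr u.2) D|.
    rewrite /B1; elim/big_rec2: _ => [|u m S _ h]; first by rewrite cards0.
    by apply: leq_trans (leq_card_setU _ _).1 _; rewrite leq_add2l.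
  apply: leq_trans (leq_mul (leqnn _) cB1) _; rewrite big_distrr /=.
  rewrite -card_prod -sum_nat_const; apply: leq_sum => u _.
  have dn x : d <= #|nbr x|.
    exact: leq_trans (min_degree_le H x) (degree_nbr x H_simple).
  exact: few_hits_tail (dn _) (dn _) d4 dD.
have h1 : D * #|B2| <= 128 * \sum_(g in fpf_invols T) #|short_cycle_darts mu g l|.
  rewrite mulnC -sum_nat_const big_distrr /= [X in _ <= X](bigID (mem B2)) /=.
  apply: leq_trans (leq_addr _ _).
  rewrite [X in _ <= X](eq_bigl (mem B2)); last first.
    by move=> g; rewrite !inE; case: (fpf_invol g).
  by apply: leq_sum => g; rewrite !inE => /andP [_ /ltnW].
have h2 := card_short_cycle_darts (mateK M_matching) l.
move: h1 h2; rewrite -/mu -/n.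
move: (\sum_(g in _) _) (#|B2|) (#|fpf_invols T|) => s b p h1 h2.
have h3 : n * s <= 2 * (n * l * p).
  apply: (@leq_trans (2 * (s * (n - l.*2)))); last by rewrite leq_mul2l.
  (* Since [4 * l <= n], the denominator [n - 2 * l] costs a factor 2, turning 128 into 256. *)
  have nl : n <= 2 * (n - l.*2) by move: ln; clear; lia.
  by rewrite mulnCA mulnC leq_mul2l nl orbT.
have n0 : 0 < n by move: ln l0; clear; lia.
have h4 : s <= 2 * (l * p).
  by rewrite -(leq_pmul2l n0); apply: leq_trans h3 _; clear; lia.
by move: h1 h4; clear; lia.
Qed.

(* [C * n * t <= D ^ 2] is the hypothesis alpha >> (log n / n)^(1/4): here
   [t] stands for log n and [D] for alpha^2 n up to a constant. *)
Lemma not_pancyclic_bound C D t : 128 * 65 <= C -> 0 < n -> 0 < t -> n <= 2 ^ t ->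
  32 * D * n <= d ^ 2 -> C * n * t <= D ^ 2 -> 128 * (n - #|cover M|) <= D ->
  C * #|[set G | perfect_matching G && ~~ pancyclic (H :|: G)]| <=
    (256 * 65 + 1) * #|[set G : {set {set T}} | perfect_matching G]|.
Proof.
move=> C0 n0 t0 nt dD CD uD.
have /card_gt0P [x _] := n0.
have dn : d <= n.
  apply: leq_trans (min_degree_le H x) _; apply: leq_trans (degree_nbr x H_simple) _.
  exact: max_card.
have D32 : 32 * D <= n.
  rewrite -(leq_pmul2r n0); apply: leq_trans dD _; rewrite expnS expn1.
  exact: leq_mul.
have D0 : 0 < D.
  rewrite lt0n; apply/eqP => D0; move: CD.
  by rewrite D0 exp0n // leqNgt !muln_gt0 n0 t0 (leq_trans _ C0).
have {}CD : C * n * t <= D * D by rewrite mulnn.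
have DC : 32 * C * t <= D.
  rewrite -(leq_pmul2r n0); move: CD (leq_mul D32 (leqnn D)); clear; lia.
(* The path length is about [64 * n / D]; rounding up costs at most [D <= n], whence the 65. *)
pose l := (64 * n) %/ D + 1.
have l1 : 64 * n <= l * D.
  by rewrite /l; have := divn_eq (64 * n) D; have := ltn_pmod (64 * n) D0; nia.
have l2 : l * D <= 65 * n.
  by rewrite /l; have := leq_divM (64 * n) D; nia.
have l0 : 0 < l by rewrite /l addn1.
clearbody l.
have CnD : C * n <= D * D by apply: leq_trans CD; rewrite leq_pmulr.
have Ct : C <= C * t by rewrite leq_pmulr.
have tC : t <= C * t by rewrite leq_pmull // (leq_trans _ C0).
have big : 2 * (n * n) < 2 ^ (D %/ (32 * l)).
  (* As [l * D <= 65 * n] and [2 * t + 2 <= 4 * t], it suffices that [128 * 65 * n * t <= D ^ 2];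
     hence the lower bound on [C]. *)
  have tl : t + t + 2 <= D %/ (32 * l).
    rewrite leq_divRL ?muln_gt0 // -(leq_pmul2r D0).
    have : (t + t + 2) * (32 * (l * D)) <= (4 * t) * (32 * (65 * n)).
      by apply: leq_mul; [move: t0; clear; lia|rewrite leq_mul2l].
    move=> h; apply: leq_trans CD; apply: (@leq_trans (128 * 65 * n * t)).
      by move: h; clear; lia.
    by rewrite !leq_mul2r C0 !orbT.
  apply: leq_trans (leq_pexp2l _ tl) => //.
  rewrite !expnD; have := leq_mul nt nt.
  have : 0 < n * n by rewrite muln_gt0 n0.
  move: (n * n) (2 ^ t * 2 ^ t) => a b; clear; lia.
have d4 : 4 <= d.
  rewrite leqNgt; apply/negP => d3; move: dD; rewrite expnS expn1.
  have : d * d <= 9 by apply: (@leq_mul _ _ 3 3).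
  have : 0 < D * n by rewrite muln_gt0 D0.
  clear; lia.
have ln : 4 * l <= n.
  rewrite -(leq_pmul2r D0); apply: (@leq_trans (n * 260)).
    by move: l2; clear; lia.
  by rewrite leq_mul2l; apply/orP; right; move: DC Ct C0; clear; lia.
have [b1 [b2 [hb h1 h2]]] := card_not_pancyclic D0 l0 d4 dD uD l1 big ln.
have -> : #|[set G : {set {set T}} | perfect_matching G]| = #|fpf_invols T|.
  have := card_pm (fun _ : {set {set T}} => true).
  rewrite (_ : [set M0 | _ & true] = [set G : {set {set T}} | perfect_matching G]).
    by move=> ->; apply: eq_card => g; rewrite !inE andbT.
  by apply/setP => G; rewrite !inE andbT.
rewrite (card_pm (fun G => ~~ pancyclic (H :|: G))).
apply: leq_trans (leq_mul (leqnn C) hb) _; rewrite mulnDr.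
move: (#|fpf_invols T|) h1 h2 => p h1 h2.
(* The exponential tail absorbs the union over pairs: [C * n ^ 2 <= 2 ^ (C + 2 * t) <= 2 ^ D]. *)
have e1 : C * b1 <= p.
  have nD : C * (n * n) <= 2 ^ D.
    apply: (@leq_trans (2 ^ (C + (t + t)))); last first.
      by apply: leq_pexp2l => //; move: DC Ct tC; clear; lia.
    rewrite !expnD leq_mul ?leq_mul //; exact/ltnW/ltn_expl.
  have nn0 : 0 < n * n by rewrite muln_gt0 n0.
  rewrite -(leq_pmul2l nn0); apply: leq_trans h1.
  rewrite mulnA (mulnC _ C); exact: leq_mul.
(* Markov's ratio [256 * l / D] is at most [256 * 65 / C], because [l * D <= 65 * n] and
   [C * n <= D ^ 2]. *)
have e2 : C * b2 <= 256 * 65 * p.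
  rewrite -(leq_pmul2l D0).
  have Cl : C * l <= 65 * D.
    rewrite -(leq_pmul2r D0) -mulnA; apply: leq_trans (leq_mul (leqnn C) l2) _.
    by move: CnD; clear; lia.
  apply: (@leq_trans (C * (256 * l * p))); first by rewrite mulnCA leq_mul2l h2 orbT.
  by move: (leq_mul Cl (leqnn p)); clear; lia.
by move: e1 e2; clear; lia.
Qed.

End FiniteBound.

Lemma card_pm_ord_gt0 n : ~~ odd n ->
  0 < #|[set G : {set {set 'I_n}} | perfect_matching G]|.
Proof.
move=> evn.
(* Pairs each even number with its successor; evenness of [n] keeps this in range, so [insubd] never
   returns its default. *)
pose h (i : 'I_n) : 'I_n := insubd i (if odd i then i.-1 else i.+1).
have hE (i : 'I_n) : h i = (if odd i then i.-1 else i.+1) :> nat.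
  rewrite val_insubd; case: ifP => //; case: i => i /= ni.
  by case: ifP => oi; lia.
have hK : involutive h.
  by move=> i; apply: val_inj; rewrite /= !hE; case: ifP; case: ifP; lia.
have hP : fpf_invol (perm (inv_inj hK)).
  apply/forallP => i; rewrite !permE hK eqxx andbT -val_eqE /= hE.
  by case: ifP; lia.
by apply/card_gt0P; exists (edges (perm (inv_inj hK))); rewrite inE edges_pm.
Qed.

Lemma card_pm_split (T : finType) (P : pred {set {set T}}) :
  #|[set G | perfect_matching G && P G]| +
  #|[set G | perfect_matching G && ~~ P G]| = #|[set G | @perfect_matching T G]|.
Proof.
rewrite -(cardsID [set G | P G] [set G | perfect_matching G]); congr (_ + _).
  by apply: eq_card => G; rewrite !inE.
by apply: eq_card => G; rewrite !inE andbC.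
Qed.

(** Hides the constants: the asymptotic argument only needs a failure ratio of at most [c1 / C] for
    arbitrarily large [C]. *)
Lemma not_pancyclic_ratio : exists c0 c1 : nat, 0 < c0 /\
  forall (T : finType) (H M : {set {set T}}) (C D t : nat),
  simple_graph H -> matching M -> M \subset H -> c0 <= C ->
  0 < #|T| -> 0 < t -> #|T| <= 2 ^ t ->
  32 * D * #|T| <= min_degree H ^ 2 -> C * #|T| * t <= D ^ 2 ->
  128 * (#|T| - #|cover M|) <= D ->
  C * #|[set G | perfect_matching G && ~~ pancyclic (H :|: G)]| <=
    c1 * #|[set G : {set {set T}} | perfect_matching G]|.
Proof.
exists (128 * 65), (256 * 65 + 1); split=> // T H M C D t sH mM MH.
exact: not_pancyclic_bound.
Qed.

(** * Asymptotics *)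

From mathcomp Require Import all_classical all_reals all_analysis.

Import Order.TTheory GRing.Theory Num.Theory.
Import numFieldNormedType.Exports.

Local Open Scope classical_set_scope.
Local Open Scope ring_scope.

Lemma even_oo_filter : Filter even_oo.
Proof. exact: within_filter. Qed.

Lemma near_even_oo N : \forall n \near even_oo, (N <= n)%N /\ ~~ odd n.
Proof.
rewrite /even_oo near_withinE; near=> n => en; split => //.
by near: n; exists N.
Unshelve. all: by end_near. Qed.

Lemma exists_small_ratio (R : realType) (c0 c1 : nat) (eps : R) : 0 < eps ->
  exists2 C : nat, (c0 < C)%N & c1%:R / C%:R <= eps.
Proof.
move=> eps0; set m := Num.bound (c1%:R / eps).
exists (c0 + m.+1)%N; first by rewrite addnS ltnS leq_addr.
have C0 : 0 < (c0 + m.+1)%:R :> R by rewrite ltr0n addnS.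
have h : c1%:R / eps < m%:R by apply: archi_boundP; rewrite divr_ge0 // ltW.
rewrite ler_pdivrMr // mulrC -ler_pdivrMr //; apply: le_trans (ltW h) _.
by rewrite ler_nat addnS leqW // leq_addl.
Qed.

Lemma dist_ratio_le (R : realType) (a b p c C : nat) : (0 < p)%N -> (0 < C)%N ->
  (a + b = p)%N -> (C * b <= c * p)%N ->
  `|1 - a%:R / p%:R| <= c%:R / C%:R :> R.
Proof.
move=> p0 C0 abp bc; have p0R : 0 < p%:R :> R by rewrite ltr0n.
have -> : 1 - a%:R / p%:R = b%:R / p%:R :> R.
  have pn0 : p%:R != 0 :> R by rewrite gt_eqF.
  have -> : b%:R = p%:R - a%:R :> R by rewrite -abp natrD addrAC subrr add0r.
  by rewrite mulrBl divff.
rewrite ger0_norm ?divr_ge0 // ler_pdivrMr // mulrAC ler_pdivlMr ?ltr0n //.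
by rewrite -!natrM ler_nat mulnC.
Qed.

Lemma trunc_log_le_ln (R : realType) n : (2 <= n)%N ->
  (trunc_log 2 n).+1%:R <= 2 / ln 2 * ln (n%:R : R).
Proof.
move=> n2; have l2 : 0 < ln (2 : R) by rewrite ln_gt0 // ltr1n.
rewrite mulrAC ler_pdivlMr //.
(* For [n >= 2] the binary logarithm is at least 1, so adding 1 at most doubles it. *)
have h1 : (trunc_log 2 n).+1%:R <= 2 * (trunc_log 2 n)%:R :> R.
  have : (0 < trunc_log 2 n)%N by rewrite trunc_log_gt0.
  by rewrite -(ler_nat R) -natr1; lra.
have h2 : (trunc_log 2 n)%:R * ln (2 : R) <= ln n%:R.
  rewrite mulr_natl -lnXn // ler_ln ?posrE ?exprn_gt0 ?ltr0n //; last by lia.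
  by rewrite -natrX ler_nat trunc_logP //; lia.
apply: le_trans (ler_wpM2r (ltW l2) h1) _.
by rewrite -mulrA ler_pM2l.
Qed.

(** The fourth power of the bound on [a] reads [a ^ 4 * n >= B ^ 4 * ln n], and [D] is about
    [a ^ 2 * n / 32] or more. The factor [64 * 64] is [32 ^ 2] times 4 for rounding [D] down;
    [2 / ln 2] converts [ln n] to the binary logarithm. *)
Lemma min_degree_large (R : realType) (n d C : nat) (a B : R) :
  (2 <= n)%N -> 0 <= B ->
  B <= a / (ln (n%:R : R) / n%:R) `^ (4%:R)^-1 -> a * n%:R <= d%:R ->
  (64 * 64)%:R * C%:R * (2 / ln 2) <= B ^+ 4 -> (0 < C)%N ->
  let D := (d * d %/ (32 * n))%N in
  (C * n * (trunc_log 2 n).+1 <= D ^ 2)%N /\ a ^+ 2 * n%:R <= 64 * D%:R.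
Proof.
move=> n2 B0 Ba ad BC C0 D.
set t := (trunc_log 2 n).+1.
have n0 : 0 < n%:R :> R by rewrite ltr0n ltnW.
have ln0 : 0 < ln (n%:R : R) by rewrite ln_gt0 // ltr1n.
set q := (_ `^ _) in Ba.
have q0 : 0 < q by rewrite powR_gt0 // divr_gt0.
have q4 : q ^+ 4 = ln n%:R / n%:R.
  rewrite -powR_mulrn ?ltW // /q -powRrM mulVf ?pnatr_eq0 // powRr1 //.
  by rewrite divr_ge0 // ltW.
have aq : B * q <= a by rewrite -ler_pdivlMr.
have a0 : 0 <= a by apply: le_trans aq; rewrite mulr_ge0 // ltW.
have a4 : B ^+ 4 * (ln n%:R / n%:R) <= a ^+ 4.
  by rewrite -q4 -exprMn lerXn2r ?nnegrE ?mulr_ge0 // ltW.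
pose x : R := (d%:R * d%:R) / (32 * n%:R).
have x0 : 0 <= x by rewrite divr_ge0 ?mulr_ge0 // ltW.
have ax : a ^+ 2 * n%:R <= 32 * x.
  have -> : 32 * x = d%:R * d%:R / n%:R by rewrite /x; field; rewrite gt_eqF.
  rewrite ler_pdivlMr //.
  have -> : a ^+ 2 * n%:R * n%:R = (a * n%:R) ^+ 2 by ring.
  rewrite -[X in _ <= X]expr2 lerXn2r ?nnegrE //.
  by rewrite mulr_ge0 // ltW.
have xD : x < D%:R + 1.
  rewrite /x ltr_pdivrMr ?mulr_gt0 // natr1 -!natrM ltr_nat.
  by rewrite /D -ltn_divLR // muln_gt0 (ltnW n2).
have tl : t%:R <= 2 / ln 2 * ln (n%:R : R) by exact: trunc_log_le_ln.
have x2 : (C * n * t)%:R * 4 <= x ^+ 2.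
  have h1 : (a ^+ 2 * n%:R) ^+ 2 <= (32 * x) ^+ 2.
    by rewrite lerXn2r ?nnegrE ?mulr_ge0 ?exprn_ge0 // ltW.
  have h2 : B ^+ 4 * ln n%:R * n%:R <= (a ^+ 2 * n%:R) ^+ 2.
    rewrite exprMn -exprM [X in _ <= _ * X]expr2 mulrA ler_pM2r //.
    by move: a4; rewrite mulrA ler_pdivrMr.
  have h3 : (64 * 64)%:R * C%:R * t%:R <= B ^+ 4 * ln n%:R.
    apply: le_trans (ler_wpM2r (ltW ln0) BC); by rewrite -[X in _ <= X]mulrA ler_wpM2l.
  have h4 := le_trans (le_trans (ler_wpM2r (ltW n0) h3) h2) h1.
  rewrite !natrM exprMn in h4 *; clear -h4; lra.
(* With [x >= 2], rounding down loses at most half: [x <= 2 * D]. *)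
have xge2 : 2 <= x.
  rewrite -(@ler_pXn2r _ 2) ?nnegrE //; apply: le_trans x2.
  have : (1 : R) <= (C * n * t)%:R by rewrite ler1n !muln_gt0 C0 (ltnW n2).
  by rewrite expr2; lra.
have Dx : x <= 2 * D%:R by lra.
split; last by lra.
rewrite -(ler_nat R) natrX.
have : x ^+ 2 <= (2 * D%:R) ^+ 2 by rewrite lerXn2r ?nnegrE ?mulr_ge0.
move: x2; move: (_%:R : R) (x ^+ 2) => u v; rewrite exprMn; clear; lra.
Qed.

Unset Implicit Arguments.

Theorem theorem1p3 (R : realType) (alpha f : nat -> R)
    (H : forall n : nat, {set {set 'I_n}})
    (alpha_large :
      (alpha n / (ln (n%:R : R) / n%:R) `^ (4%:R)^-1) @[n --> even_oo] --> +oo)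
    (f_small : f =o_even_oo (fun n : nat => alpha n ^+ 2 * n%:R))
    (H_graph : forall n : nat, (0 < n)%N -> ~~ odd n -> simple_graph (H n))
    (H_degree : forall n : nat, (0 < n)%N -> ~~ odd n ->
      alpha n * n%:R <= (min_degree (H n))%:R)
    (H_matching : forall n : nat, (0 < n)%N -> ~~ odd n ->
      exists M : {set {set 'I_n}},
        [/\ matching M, M \subset H n & n%:R - f n <= #|finset.cover M|%:R]) :
  prob_pm R (fun G : {set {set 'I_n}} => pancyclic (H n :|: G))
    @[n --> even_oo] --> (1 : R).
Proof.
have FF := even_oo_filter.
have /cvgryPge aL := alpha_large.
have /eqoP fS := f_small.
apply/cvgrPdist_le => eps eps0.
have [c0 [c1 [c00 bound]]] := not_pancyclic_ratio.
have [C C0 Ceps] := exists_small_ratio c0 c1 eps0.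
pose K : R := (64 * 64)%:R * C%:R * (2 / ln 2).
have K0 : 0 <= K by rewrite !mulr_ge0 // invr_ge0 ln_ge0 // ler1n.
(* Adding 1 ensures [B >= 1], hence [B ^ 4 >= B >= K]. *)
pose B := 1 + K.
have BK : K <= B ^+ 4.
  apply: (@le_trans _ _ B); first by rewrite lerDr.
  by rewrite ler_eXnr // lerDl.
(* With this constant in the little-o bound, [128 * f n <= alpha n ^ 2 * n / 64 <= D], as required
   of the unmatched vertices. *)
have e1 : 0 < (128^-1 / 64 : R) by rewrite divr_gt0 // invr_gt0.
near=> n.
have [n2 evn] : (2 <= n)%N /\ ~~ odd n by near: n; exact: near_even_oo.
have aB : B <= alpha n / (ln (n%:R : R) / n%:R) `^ (4%:R)^-1 by near: n; exact: aL.
have fn : `|f n| <= (128^-1 / 64) * `|alpha n ^+ 2 * n%:R| by near: n; exact: fS.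
have n0 : (0 < n)%N := ltnW n2.
have [M [mM MH cM]] := H_matching n n0 evn.
have [CD aD] := min_degree_large n2 (addr_ge0 ler01 K0) aB (H_degree n n0 evn) BK
  (leq_ltn_trans (leq0n c0) C0).
move: CD aD; set D := (_ %/ _)%N => CD aD.
have dD : (32 * D * #|'I_n| <= min_degree (H n) ^ 2)%N.
  by rewrite card_ord -mulnAC mulnC -mulnn leq_divM.
have uD : (128 * (#|'I_n| - #|finset.cover M|) <= D)%N.
  rewrite -(ler_nat R) natrM card_ord natrB; last first.
    by rewrite -[X in (_ <= X)%N]card_ord max_card.
  have : f n <= (128^-1 / 64) * (alpha n ^+ 2 * n%:R).
    apply: le_trans (ler_norm _) _; apply: le_trans fn _.
    by rewrite ger0_norm // mulr_ge0 // sqr_ge0.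
  lra.
have := bound _ _ _ C D (trunc_log 2 n).+1 (H_graph n n0 evn) mM MH (ltnW C0).
move=> /(_ _ isT _ dD _ uD); rewrite card_ord.
move=> /(_ n0 (ltnW (@trunc_log_ltn 2 n isT)) CD) bad.
have pm0 := card_pm_ord_gt0 evn.
have sp := card_pm_split (fun G : {set {set 'I_n}} => pancyclic (H n :|: G)).
exact: le_trans (dist_ratio_le R pm0 (leq_ltn_trans (leq0n c0) C0) sp bad) Ceps.
Unshelve. all: by end_near. Qed.
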